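(* Let $P$ be a probability measure on $\Omega=\{0,1\}^{\mathbb{N}}$ and $A$ an oracle (an element of $\Omega$, or a set of naturals) such that $P$ is computable relative to $A$ and, conversely, $A$ can be effectively computed from approximations of arbitrary precision to the values of $P$. Then a sequence $\omega\in\Omega$ is uniformly random with respect to $P$ if and only if it is Martin-Löf random with respect to $P$ with oracle $A$.
   Context: $P$ computable relative to $A$: there is an oracle algorithm with oracle $A$ that, given a word $y$ and rational $\varepsilon>0$, outputs a rational within $\varepsilon$ of $P(y)=P(y\Omega)$. $A$ computable from approximations to $P$: there is an algorithm which, given any oracle providing rational approximations of arbitrary precision to all values $P(y)$, computes $A$. $\mathcal{M}(\Omega)$ is the space of probability measures on $\Omega$, topologized by basic sets given by finitely many conditions $u<P(y)<v$ (rational $u,v$); a basic open set of $\Omega\times\mathcal{M}(\Omega)$ is $x\Omega\times\beta$. A function $t:\Omega\times\mathcal{M}(\Omega)\to[0,\infty]$ is lower semicomputable if each $\{(\omega,P):r<t(\omega,P)\}$, $r$ rational, is the union of an enumerable family of basic open sets, uniformly in $r$. A uniform test is such a $t$ with $\int t(\omega,P)\,dP(\omega)\le1$ for every $P$; there is a universal (maximal up to a multiplicative constant) uniform test $\mathbf{t}$, and $\omega$ is uniformly random with respect to $P$ if $\mathbf{t}(\omega,P)<\infty$. Martin-Löf randomness w.r.t. $P$ with oracle $A$: $\omega\notin\bigcap_iU_i$ for every sequence of sets $U_i$, unions of families of intervals enumerable with oracle $A$ uniformly in $i$, with $P(U_i)\le2^{-i}$. *)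

(* Defs.v *)
From HB Require Import structures.
From Stdlib Require Cantor.
From mathcomp Require Import all_boot all_order all_algebra.
From mathcomp Require Import all_classical all_reals all_analysis.

Set Implicit Arguments.
Unset Strict Implicit.
Unset Printing Implicit Defensive.

Import Order.TTheory GRing.Theory Num.Theory.
Import numFieldNormedType.Exports.

Local Open Scope classical_set_scope.
Local Open Scope ring_scope.

(* Cantor's bijection nat * nat -> nat. *)
Definition pairing (a b : nat) : nat := Cantor.to_nat (a, b).

(** Algorithms with an oracle o : nat -> nat: partial recursive functions of one
    argument, tuples being packed with [pairing]. *)
Inductive program : Type :=
| Zero
| Succ
| Fst
| Snd
| Query
| Pair of program & program
| Comp of program & program
| PrimRec of program & program
| Mu of program.

(* [eval o p n m]: on input n and with oracle o, p halts with output m. *)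
Inductive eval (o : nat -> nat) : program -> nat -> nat -> Prop :=
| eval_Zero n : eval o Zero n 0%N
| eval_Succ n : eval o Succ n n.+1
| eval_Fst a b : eval o Fst (pairing a b) a
| eval_Snd a b : eval o Snd (pairing a b) b
| eval_Query n : eval o Query n (o n)
| eval_Pair p q n a b :
    eval o p n a -> eval o q n b -> eval o (Pair p q) n (pairing a b)
| eval_Comp p q n m k :
    eval o q n m -> eval o p m k -> eval o (Comp p q) n k
| eval_PrimRec0 p q a r :
    eval o p a r -> eval o (PrimRec p q) (pairing a 0%N) r
| eval_PrimRecS p q a n r s :
    eval o (PrimRec p q) (pairing a n) r ->
    eval o q (pairing a (pairing n r)) s ->
    eval o (PrimRec p q) (pairing a n.+1) s
(* the values [(f k).+1] witness that p halts with nonzero output below n *)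
| eval_Mu p a n (f : nat -> nat) :
    (forall k, (k < n)%N -> eval o p (pairing a k) (f k).+1) ->
    eval o p (pairing a n) 0%N -> eval o (Mu p) a n.

Definition no_oracle : nat -> nat := fun=> 0%N.

Definition set_oracle (A : nat -> bool) : nat -> nat := fun n => A n.

Definition code_seq (T : Type) (c : T -> nat) (s : seq T) : nat :=
  foldr (fun x n => (pairing (c x) n).+1) 0%N s.

Definition code_word (y : seq bool) : nat := code_seq nat_of_bool y.

(* sign, absolute value of the numerator, denominator of the reduced fraction *)
Definition code_rat (q : rat) : nat :=
  pairing (pairing (numq q < 0)%R `|numq q|%N) `|denq q|%N.

(* The set of objects (coded by c) that p, given i, enumerates with oracle o:
   those whose code is output on some input (i, k).  Every recursively enumerable
   set is of this form, p being allowed to diverge on some k; outputs that code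
   no object are ignored. *)
Definition enumerated (T : Type) (c : T -> nat) (o : nat -> nat) (p : program)
    (i : nat) : set T :=
  [set x | exists k, eval o p (pairing i k) (c x)].

(** The Cantor space with the sigma-algebra generated by the intervals y Omega,
    that is, its Borel sigma-algebra. *)
Definition cylinder (y : seq bool) : set (nat -> bool) :=
  [set w | mkseq w (size y) = y].

Definition Omega := g_sigma_algebraType (range cylinder).

Section measures.
Variable R : realType.
Local Open Scope ereal_scope.
Implicit Types (P : probability Omega R) (A : nat -> bool)
  (t : Omega -> probability Omega R -> \bar R).

(* F relates the codes of pairs (y, eps) to codes of rationals within eps of P(y);
   it is either the input-output relation of an algorithm or the graph of an
   oracle. *)
Definition approximates P (F : nat -> nat -> Prop) : Prop :=
  forall (y : seq bool) (eps : rat), (0 < eps)%R ->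
    exists2 r : rat, F (pairing (code_word y) (code_rat eps)) (code_rat r) &
      `| (ratr r)%:E - P (cylinder y) | <= (ratr eps)%:E.

Definition computable_relative_to P A : Prop :=
  exists p : program, approximates P (eval (set_oracle A) p).

Definition computable_from_approximations A P : Prop :=
  exists p : program, forall o : nat -> nat,
    approximates P (fun n m => o n = m) -> forall n, eval o p n (A n).

(* ((y, u), v) stands for the condition u < P(y) < v. *)
Definition condition : Type := seq bool * rat * rat.

Definition code_condition (c : condition) : nat :=
  pairing (pairing (code_word c.1.1) (code_rat c.1.2)) (code_rat c.2).

Definition satisfies P (c : condition) : Prop :=
  (ratr c.1.2)%:E < P (cylinder c.1.1) < (ratr c.2)%:E.

Definition code_basic (b : seq bool * seq condition) : nat :=
  pairing (code_word b.1) (code_seq code_condition b.2).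

Definition basic_open (b : seq bool * seq condition) :
    set (Omega * probability Omega R) :=
  [set wP | cylinder b.1 wP.1 /\ forall c, c \in b.2 -> satisfies wP.2 c].

Definition lower_semicomputable t : Prop :=
  exists p : program, forall r : rat,
    [set wP | (ratr r)%:E < t wP.1 wP.2] =
    \bigcup_(b in enumerated code_basic no_oracle p (code_rat r)) basic_open b.

Definition uniform_test t : Prop :=
  [/\ forall w P, 0 <= t w P,
      lower_semicomputable t &
      forall P, \int[P]_w t w P <= 1].

Definition universal_uniform_test t : Prop :=
  uniform_test t /\
  forall t', uniform_test t' ->
    exists2 c : R, (0 < c)%R & forall w P, t' w P <= c%:E * t w P.

(* t is meant to be a universal uniform test; by maximality, all choices of it
   give the same notion. *)
Definition uniformly_random t P (w : Omega) : Prop := t w P < +oo.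

Definition martin_lof_test P A (U : nat -> set Omega) : Prop :=
  (exists p : program, forall i,
     U i = \bigcup_(x in enumerated code_word (set_oracle A) p i) cylinder x) /\
  forall i, P (U i) <= ((2^-1 : R) ^+ i)%:E.

Definition martin_lof_random P A (w : Omega) : Prop :=
  forall U, martin_lof_test P A U -> ~ (\bigcap_i U i) w.

End measures.

(* Main.v *)
From Stdlib Require Cantor.
Require Import Defs.
From mathcomp Require Import all_boot all_order all_algebra.
From mathcomp Require Import all_classical all_reals all_analysis.
From mathcomp Require Import measurable_realfun zify ring lra.
Import Defs.

Set Implicit Arguments.
Unset Strict Implicit.
Unset Printing Implicit Defensive.

(* If w is not uniformly random, the sets {2 ^ i < t(., P)} form a Martin-Löf
   test relative to A by Markov's inequality: A decides arbitrarily precisely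
   which conditions P satisfies.

   Conversely, composing a Martin-Löf test relative to A with the algorithm that
   computes A from approximations to P gives an enumeration that runs from the
   approximations to any measure Q, hence effectively open sets S_i of pairs
   (w, Q) whose slice at P is the given test; but Q(S_i) may be large for Q <> P,
   and Q itself is not available to the algorithm when it trims S_i.  At stage k,
   let M_k(Q) be the union of the intervals enumerated so far on a condition that
   Q satisfies with margin 1/(k+1), in the wide sense.  This set increases with k,
   depends on Q upper semicontinuously, and exhausts S_i; so "Q(M_k(Q)) is small"
   is an effectively open condition on Q, and keeping only the stages where it
   holds gives effectively open sets of small Q-measure that coincide with S_i
   at P.  They combine into a uniform test that is infinite on the original
   one. *)

(** At a measure Q other than P, the program computing A from approximations may be silent or
    inconsistent: different oracle beginnings compatible with Q can give different values. Hence
    oracles are treated as relations, and a finite beginning is an oracle without answers beyond its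
    end. A program sees Q only through finitely many strict conditions, so the bound on Q(M_k(Q))
    needs a finite certificate: strict upper bounds on the measures of covering intervals, and
    refutations of the conditions attached to all other intervals of the stage. This is why M_k uses
    closed conditions: the failure of a closed condition is witnessed by a strict one. Certified
    stages are nested for each Q, so their union obeys the bound of a single stage and nothing is
    summed over stages. Constants: S_i comes from level 2i+1 of the given test, whose P-measure is
    at most half of 4^-i. The gap below 4^-i absorbs the rounding in certificates, and the sum of i
    4^-i is at most 1, which bounds the integral of the combined test. *)

(** * Semantics of programs *)

(* Sealed, for unification would otherwise unfold Cantor's bijection. *)
Fact unpair_spec : {f : nat -> nat * nat |
  (forall a b, f (pairing a b) = (a, b)) /\ forall n, pairing (f n).1 (f n).2 = n}.
Proof.
exists Cantor.of_nat; split=> [a b|n]; first exact: Cantor.cancel_of_to.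
by rewrite /pairing -surjective_pairing; exact: Cantor.cancel_to_of.
Qed.

Definition unpair : nat -> nat * nat := sval unpair_spec.

Lemma pairingK a b : unpair (pairing a b) = (a, b).
Proof. exact: (svalP unpair_spec).1. Qed.

Lemma unpairK n : pairing (unpair n).1 (unpair n).2 = n.
Proof. exact: (svalP unpair_spec).2. Qed.

Lemma pairing_inj a b c d : pairing a b = pairing c d -> a = c /\ b = d.
Proof. by move=> /(congr1 unpair); rewrite !pairingK => -[]. Qed.

Lemma leq_pairingr a b : b <= pairing a b.
Proof.
have /leP := Cantor.to_nat_non_decreasing a b.
by apply: leq_trans; rewrite leq_addr.
Qed.

Opaque pairing.

Definition graph (o : nat -> nat) (n m : nat) : Prop := o n = m.

(* The input-output relation of p when its oracle is a relation, such as a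
   finite piece of a function or the input-output relation of another program;
   in the case of [PrimRec], s lists the intermediate values. *)
Fixpoint sem (rho : nat -> nat -> Prop) (p : program) (n m : nat) : Prop :=
  match p with
  | Zero => m = 0
  | Succ => m = n.+1
  | Fst => m = (unpair n).1
  | Snd => m = (unpair n).2
  | Query => rho n m
  | Pair p q => sem rho p n (unpair m).1 /\ sem rho q n (unpair m).2
  | Comp p q => exists k, sem rho q n k /\ sem rho p k m
  | PrimRec p q => exists s : seq nat,
      [/\ sem rho p (unpair n).1 (nth 0 s 0),
          forall j, j < (unpair n).2 ->
            sem rho q (pairing (unpair n).1 (pairing j (nth 0 s j)))
              (nth 0 s j.+1)
        & nth 0 s (unpair n).2 = m]
  | Mu p =>
      (forall k, k < m -> exists v, sem rho p (pairing n k) v.+1) /\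
      sem rho p (pairing n m) 0
  end.

Lemma sem_sub (rho rho' : nat -> nat -> Prop) p :
  (forall n m, rho n m -> rho' n m) ->
  forall n m, sem rho p n m -> sem rho' p n m.
Proof.
move=> sub; elim: p => //=.
- by move=> p IHp q IHq n m [/IHp ? /IHq ?].
- by move=> p IHp q IHq n m [k [/IHq ? /IHp ?]]; exists k.
- move=> p IHp q IHq n m [s [/IHp ? sS ?]]; exists s; split=> // j /sS.
  exact: IHq.
- move=> p IHp n m [lt_m /IHp ?]; split=> // k /lt_m[v /IHp ?]; by exists v.
Qed.

Lemma bounded_choice (chi : nat -> nat -> Prop) m :
  (forall k N N', N <= N' -> chi k N -> chi k N') ->
  (forall k, k < m -> exists N, chi k N) ->
  exists N, forall k, k < m -> chi k N.
Proof.
move=> mono; elim: m => [|m IHm] chi_ex; first by exists 0.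
have [N chiN] := IHm (fun k lt_km => chi_ex k (ltnW lt_km)).
have [N' chiN'] := chi_ex m (ltnSn m).
exists (maxn N N') => k; rewrite ltnS leq_eqVlt => /orP[/eqP->|/chiN].
  by apply: mono chiN'; exact: leq_maxr.
by apply: mono; exact: leq_maxl.
Qed.

(** The use principle: a halting computation asks finitely many questions, so one stage of an
    increasing family of oracles answers them all. In the [PrimRec] and [Mu] cases, [bounded_choice]
    finds a stage common to finitely many subcomputations. *)
Lemma sem_cont (rho : nat -> nat -> nat -> Prop) p n m :
  (forall N N' a b, N <= N' -> rho N a b -> rho N' a b) ->
  sem (fun a b => exists N, rho N a b) p n m -> exists N, sem (rho N) p n m.
Proof.
move=> mono.
have up N N' r a b : N <= N' -> sem (rho N) r a b -> sem (rho N') r a b.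
  by move=> le_N; apply: sem_sub => ? ?; exact: mono.
elim: p n m => /=; try by move=> n m ?; exists 0.
- by [].
- move=> p IHp q IHq n m [/IHp[N pN] /IHq[N' qN']].
  exists (maxn N N'); split; first exact: up (leq_maxl _ _) pN.
  exact: up (leq_maxr _ _) qN'.
- move=> p IHp q IHq n m [k [/IHq[N qN] /IHp[N' pN']]].
  exists (maxn N N'), k; split; first exact: up (leq_maxl _ _) qN.
  exact: up (leq_maxr _ _) pN'.
- move=> p IHp q IHq n m [s [/IHp[N pN] sS lasts]].
  have [|N' qN'] := @bounded_choice (fun j N => sem (rho N) q
      (pairing (unpair n).1 (pairing j (nth 0 s j))) (nth 0 s j.+1))
      (unpair n).2 _ (fun j lt_j => IHq _ _ (sS j lt_j)).
    by move=> k M M'; exact: up.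
  exists (maxn N N'), s; split=> //; first exact: up (leq_maxl _ _) pN.
  by move=> j /qN'; exact: up (leq_maxr _ _).
- move=> p IHp n m [lt_m /IHp[N pN]].
  have [||N' pN'] := @bounded_choice (fun k N =>
      exists v, sem (rho N) p (pairing n k) v.+1) m.
  + by move=> k M M' le_M [v v_]; exists v; exact: up v_.
  + by move=> k /lt_m[v /IHp[M M_]]; exists M, v.
  exists (maxn N N'); split; last exact: up (leq_maxl _ _) pN.
  by move=> k /pN'[v v_]; exists v; exact: up (leq_maxr _ _) v_.
Qed.

(** Two results of [Mu] cannot differ: at the smaller one, [p] would output both zero and a
    successor. *)
Lemma sem_fun (rho : nat -> nat -> Prop) p n m m' :
  (forall a b b', rho a b -> rho a b' -> b = b') ->
  sem rho p n m -> sem rho p n m' -> m = m'.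
Proof.
move=> rho_fun; elim: p n m m' => /=; try by move=> n m m' -> ->.
- exact: rho_fun.
- move=> p IHp q IHq n m m' [p1 q1] [p2 q2].
  by rewrite -(unpairK m) -(unpairK m') (IHp _ _ _ p1 p2) (IHq _ _ _ q1 q2).
- move=> p IHp q IHq n m m' [k [q1 p1]] [k' [q2 p2]].
  by move: p1; rewrite (IHq _ _ _ q1 q2) => p1; exact: IHp p1 p2.
- move=> p IHp q IHq n m m' [s [s0 sS <-]] [s' [s'0 s'S <-]].
  elim: (unpair n).2 sS s'S => [|N IHN] sS s'S; first exact: IHp s0 s'0.
  have eqN : nth 0 s N = nth 0 s' N.
    by apply: IHN => j lt_j; [apply: sS|apply: s'S]; exact: ltnW.
  by have := s'S N (ltnSn N); rewrite -eqN; apply: IHq; exact: sS.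
- move=> p IHp n m m' [lt_m pm] [lt_m' pm'].
  case: (ltngtP m m') => // [/lt_m'[v v_]|/lt_m[v v_]].
    by have := IHp _ _ _ pm v_.
  by have := IHp _ _ _ pm' v_.
Qed.

(** [sem] allows induction on the program and a change of oracle, whereas [eval] is tied to a total
    function. *)
Lemma evalP o p n m : eval o p n m <-> sem (graph o) p n m.
Proof.
split.
  elim=> //=.
  - by move=> a b; rewrite pairingK.
  - by move=> a b; rewrite pairingK.
  - by move=> *; rewrite pairingK.
  - by move=> {}p q {}n {}m k _ IHq _ IHp; exists m.
  - by move=> {}p q a r _ IHp; exists [:: r]; rewrite pairingK.
  - move=> {}p q a {}n r s _ [l]; rewrite !pairingK /= => -[l0 lS lr] _ IHq.
    (* The trace [l] may be longer than needed, so its entry [n.+1] is overwritten rather than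
       appended. *)
    exists (set_nth 0 l n.+1 s); split; rewrite ?nth_set_nth /= ?eqxx //.
    move=> j; rewrite ltnS leq_eqVlt !nth_set_nth /= => /orP[/eqP->|lt_j].
      by rewrite eqxx ltn_eqF // lr.
    by rewrite eqSS !ltn_eqF //; [exact: lS|exact: ltnW].
  - by move=> {}p a {}n f _ IHf _ IHn; split=> // k /IHf ?; exists (f k).
elim: p n m => /=.
- by move=> n m ->; constructor.
- by move=> n m ->; constructor.
- by move=> n m ->; rewrite -{1}(unpairK n); constructor.
- by move=> n m ->; rewrite -{1}(unpairK n); constructor.
- by move=> n m <-; constructor.
- move=> p IHp q IHq n m [/IHp ? /IHq ?]; rewrite -(unpairK m); exact: eval_Pair.
- move=> p IHp q IHq n m [k [/IHq ? /IHp ?]]; exact: (@eval_Comp _ _ _ _ k).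
- move=> p IHp q IHq n m [s [/IHp s0 sS <-]]; rewrite -{1}(unpairK n).
  elim: (unpair n).2 sS => [|N IHN] sS; first exact: eval_PrimRec0.
  apply: (@eval_PrimRecS _ _ _ _ _ (nth 0 s N)); last by apply: IHq; exact: sS.
  by apply: IHN => j lt_j; apply: sS; exact: ltnW.
- move=> p IHp n m [lt_m /IHp pm].
  have [f f_] : exists f, forall k, k < m -> sem (graph o) p (pairing n k) (f k).+1.
    have [f f_] := @choice nat nat
      (fun k v => k < m -> sem (graph o) p (pairing n k) v.+1)
      (fun k => match pselect (k < m) with
       | left lt_k => let: ex_intro v v_ := lt_m k lt_k in ex_intro _ v (fun=> v_)
       | right nlt => ex_intro _ 0 (fun lt_k => False_ind _ (nlt lt_k)) end).
    by exists f.
  by apply: (eval_Mu (f := f)) => // k /f_; exact: IHp.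
Qed.

Lemma eval_fun o p n m m' : eval o p n m -> eval o p n m' -> m = m'.
Proof.
by move=> /evalP ? /evalP; apply: sem_fun; first by move=> a b b' <- <-.
Qed.

Lemma eval_CompE o p q n k :
  eval o (Comp p q) n k -> exists2 m, eval o q n m & eval o p m k.
Proof. by move=> e; inversion e; exists m. Qed.

Lemma eval_PairE o p q n m :
  eval o (Pair p q) n m -> eval o p n (unpair m).1 /\ eval o q n (unpair m).2.
Proof. by move=> e; inversion e; rewrite pairingK. Qed.

Lemma eval_MuE o p n m : eval o (Mu p) n m -> eval o p (pairing n m) 0.
Proof. by move=> e; inversion e. Qed.

Lemma eval_fst o n : eval o Fst n (unpair n).1.
Proof. exact/evalP. Qed.

Lemma eval_snd o n : eval o Snd n (unpair n).2.
Proof. exact/evalP. Qed.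

Definition prog_id : program := Pair Fst Snd.

Lemma eval_id o n : eval o prog_id n n.
Proof. by rewrite -{2}(unpairK n); apply: eval_Pair; [exact: eval_fst|exact: eval_snd]. Qed.

Fixpoint prog_const (k : nat) : program :=
  if k is k.+1 then Comp Succ (prog_const k) else Zero.

Lemma eval_const o k n : eval o (prog_const k) n k.
Proof.
elim: k => [|k IHk] /=; first by constructor.
exact: eval_Comp IHk (eval_Succ _ _).
Qed.

(* If c outputs 1, both branches are run, but the first is not if c outputs 0. *)
Definition prog_if (c p q : program) : program :=
  Comp (PrimRec q (Comp p Fst)) (Pair prog_id c).

Lemma eval_if0 o c p q n m :
  eval o c n 0 -> eval o q n m -> eval o (prog_if c p q) n m.
Proof.
move=> c0 qm; apply: (@eval_Comp _ _ _ _ (pairing n 0)); last exact: eval_PrimRec0.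
exact: eval_Pair (eval_id _ _) c0.
Qed.

Lemma eval_if1 o c p q n m k :
  eval o c n 1 -> eval o q n k -> eval o p n m -> eval o (prog_if c p q) n m.
Proof.
move=> c1 qk pm; apply: (@eval_Comp _ _ _ _ (pairing n 1)).
  exact: eval_Pair (eval_id _ _) c1.
apply: (@eval_PrimRecS _ _ _ _ _ k); first exact: eval_PrimRec0.
exact: eval_Comp (eval_Fst _ _ _) pm.
Qed.

Definition prog_pred : program :=
  Comp (PrimRec Zero (Comp Fst Snd)) (Pair Zero prog_id).

Lemma eval_pred o n : eval o prog_pred n n.-1.
Proof.
apply: (@eval_Comp _ _ _ _ (pairing 0 n)).
  by apply: eval_Pair (eval_id _ _); constructor.
elim: n => [|n IHn] /=; first by do 2 constructor.
apply: (eval_PrimRecS IHn).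
by apply: eval_Comp (eval_Snd _ _ _) (eval_Fst _ _ _).
Qed.

Definition prog_gt0 : program :=
  Comp (PrimRec Zero (prog_const 1)) (Pair Zero prog_id).

Lemma eval_gt0 o n : eval o prog_gt0 n (0 < n).
Proof.
apply: (@eval_Comp _ _ _ _ (pairing 0 n)).
  by apply: eval_Pair (eval_id _ _); constructor.
elim: n => [|n IHn] /=; first by do 2 constructor.
by apply: (eval_PrimRecS IHn); exact: eval_const.
Qed.

(** * Computable functions and recursively enumerable relations *)

Class coded (X : Type) := Coded { code : X -> nat; code_inj : injective code }.

#[export] Instance nat_coded : coded nat := {| code := id; code_inj := fun _ _ e => e |}.

Lemma bool_code_inj : injective nat_of_bool.
Proof. by case=> -[]. Qed.

#[export] Instance bool_coded : coded bool :=
  {| code := nat_of_bool; code_inj := bool_code_inj |}.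

Lemma pair_code_inj X Y (cX : coded X) (cY : coded Y) :
  injective (fun p : X * Y => pairing (code p.1) (code p.2)).
Proof.
by move=> [x y] [x' y'] /= /pairing_inj[e e']; rewrite (code_inj e) (code_inj e').
Qed.

#[export] Instance pair_coded X Y (cX : coded X) (cY : coded Y) :
  coded (X * Y) := {| code := _; code_inj := @pair_code_inj X Y cX cY |}.

(** With this coding [Some (a, s)] and [a :: s] have the same code, so passing between them requires
    no computation. *)
Lemma option_code_inj X (cX : coded X) :
  injective (fun x : option X => if x is Some x then (code x).+1 else 0).
Proof. by move=> [x|] [y|] //= [e]; rewrite (code_inj e). Qed.

#[export] Instance option_coded X (cX : coded X) : coded (option X) :=
  {| code := _; code_inj := @option_code_inj X cX |}.

Lemma code_seq_inj T (c : T -> nat) : injective c -> injective (code_seq c).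
Proof.
move=> c_inj; by elim=> [|x s IHs] [|y t] //= [/pairing_inj[/c_inj -> /IHs ->]].
Qed.

#[export] Instance seq_coded X (cX : coded X) : coded (seq X) :=
  {| code := code_seq code; code_inj := code_seq_inj code_inj |}.

Lemma code_cons X {cX : coded X} (x : X) s : code (x :: s) = (pairing (code x) (code s)).+1.
Proof. by []. Qed.

Lemma size_code X {cX : coded X} (s : seq X) : size s <= code s.
Proof.
elim: s => //= x s IHs; rewrite ltnS; exact: leq_trans IHs (leq_pairingr _ _).
Qed.

Definition computable (o : nat -> nat) X Y {cX : coded X} {cY : coded Y}
    (f : X -> Y) : Prop :=
  exists p, forall x, eval o p (code x) (code (f x)).

(** * Closure properties of computable functions *)

Section computable.
Variable o : nat -> nat.
Notation computable := (@computable o _ _ _ _).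

Section basic.
Context {X Y Z : Type} {cX : coded X} {cY : coded Y} {cZ : coded Z}.

Lemma eq_computable (f g : X -> Y) : f =1 g -> computable f -> computable g.
Proof. by move=> fg [p pP]; exists p => x; rewrite -fg. Qed.

(** A program acts on codes alone, so it computes every function whose values have the same codes;
    this is how types are changed below. *)
Lemma computable_recode (f : X -> Y) (g : X -> Z) :
  (forall x, code (f x) = code (g x)) -> computable f -> computable g.
Proof. by move=> fg [p pP]; exists p => x; rewrite -fg. Qed.

Lemma computable_id : computable (fun x : X => x).
Proof. by exists prog_id => x; exact: eval_id. Qed.

Lemma computable_cst (y : Y) : computable (fun _ : X => y).
Proof. by exists (prog_const (code y)) => x; exact: eval_const. Qed.

Lemma computable_comp (f : Y -> Z) (g : X -> Y) :
  computable f -> computable g -> computable (fun x => f (g x)).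
Proof. by move=> [p pP] [q qP]; exists (Comp p q) => x; exact: eval_Comp (qP x) (pP _). Qed.

Lemma computable_pair (f : X -> Y) (g : X -> Z) :
  computable f -> computable g -> computable (fun x => (f x, g x)).
Proof. by move=> [p pP] [q qP]; exists (Pair p q) => x; exact: eval_Pair. Qed.

Lemma computable_fst (f : X -> Y * Z) : computable f -> computable (fun x => (f x).1).
Proof.
by move=> [p pP]; exists (Comp Fst p) => x; exact: eval_Comp (pP x) (eval_Fst _ _ _).
Qed.

Lemma computable_snd (f : X -> Y * Z) : computable f -> computable (fun x => (f x).2).
Proof.
by move=> [p pP]; exists (Comp Snd p) => x; exact: eval_Comp (pP x) (eval_Snd _ _ _).
Qed.

Lemma computable_if (b : X -> bool) (f g : X -> Y) :
  computable b -> computable f -> computable g ->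
  computable (fun x => if b x then f x else g x).
Proof.
move=> [r rP] [p pP] [q qP]; exists (prog_if r p q) => x.
have := rP x; case: (b x) => rx; first exact: eval_if1 rx (qP x) (pP x).
exact: eval_if0 rx (qP x).
Qed.

Lemma computable_some (f : X -> Y) : computable f -> computable (fun x => Some (f x)).
Proof.
by move=> [p pP]; exists (Comp Succ p) => x; exact: eval_Comp (pP x) (eval_Succ _ _).
Qed.

Lemma computable_opt (b : X -> option Z) (f : X -> Z -> Y) (g : X -> Y) :
  computable b -> computable (fun p : X * Z => f p.1 p.2) -> computable g ->
  computable (fun x => if b x is Some z then f x z else g x).
Proof.
move=> [r rP] [p pP] [q qP].
(* On [None] the first branch is not run; [prog_pred] might there produce a number coding no element
   of [Z], on which [p] may diverge. *)
exists (prog_if (Comp prog_gt0 r) (Comp p (Pair prog_id (Comp prog_pred r))) q) => x.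
have := rP x; case: (b x) => [z|] rx.
  apply: eval_if1 (qP x) _; first exact: eval_Comp rx (eval_gt0 _ _).
  apply: eval_Comp (pP (x, z)); apply: eval_Pair; first exact: eval_id.
  exact: eval_Comp rx (eval_pred _ _).
by apply: eval_if0 (qP x); exact: eval_Comp rx (eval_gt0 _ _).
Qed.

Lemma computable_rec (n : X -> nat) (f : X -> Y) (g : X -> nat -> Y -> Y) :
  computable n -> computable f ->
  computable (fun p : X * (nat * Y) => g p.1 p.2.1 p.2.2) ->
  computable (fun x => nat_rect (fun=> Y) (f x) (g x) (n x)).
Proof.
move=> [r rP] [p pP] [q qP]; exists (Comp (PrimRec p q) (Pair prog_id r)) => x.
apply: eval_Comp (eval_Pair (eval_id _ _) (rP x)) _.
rewrite -[code (n x)]/(n x); elim: (n x) => [|k IHk]; first exact: eval_PrimRec0.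
exact: eval_PrimRecS IHk (qP (x, (k, _))).
Qed.

End basic.

Lemma computable2 X Y Z W (cX : coded X) (cY : coded Y) (cZ : coded Z)
    (cW : coded W) (F : Y -> Z -> W) (f : X -> Y) (g : X -> Z) :
  computable (fun p : Y * Z => F p.1 p.2) -> computable f -> computable g ->
  computable (fun x => F (f x) (g x)).
Proof.
by move=> FC fC gC; exact: (computable_comp FC (computable_pair fC gC)).
Qed.

Section seq.
Context {X Y A : Type} {cX : coded X} {cY : coded Y} {cA : coded A}.

Lemma computable_iter (n : X -> nat) (f : X -> Y) (g : X -> Y -> Y) :
  computable n -> computable f -> computable (fun p : X * Y => g p.1 p.2) ->
  computable (fun x => iter (n x) (g x) (f x)).
Proof.
move=> nC fC gC.
have C : computable (fun p : X * (nat * Y) => g p.1 p.2.2).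
  apply: (computable2 gC); first exact/computable_fst/computable_id.
  exact/computable_snd/computable_snd/computable_id.
apply: eq_computable _ (computable_rec (g := fun x _ => g x) nC fC C) => x.
by elim: (n x) => //= k ->.
Qed.

Definition uncons (s : seq A) : option (A * seq A) :=
  if s is a :: s' then Some (a, s') else None.

Lemma computable_uncons (s : X -> seq A) :
  computable s -> computable (fun x => uncons (s x)).
Proof. by apply: computable_recode => x; case: (s x). Qed.

Lemma computable_cons (a : X -> A) (s : X -> seq A) :
  computable a -> computable s -> computable (fun x => a x :: s x).
Proof.
by move=> aC sC; have := computable_some (computable_pair aC sC); apply: computable_recode.
Qed.

End seq.

Section fold.
Context {X Y A : Type} {cX : coded X} {cY : coded Y} {cA : coded A}.

Lemma computable_foldl (h : X -> Y -> A -> Y) (z : X -> Y) (s : X -> seq A) :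
  computable (fun p : X * (Y * A) => h p.1 p.2.1 p.2.2) ->
  computable z -> computable s -> computable (fun x => foldl (h x) (z x) (s x)).
Proof.
move=> hC zC sC.
pose step x (st : seq A * Y) :=
  if uncons st.1 is Some a then (a.2, h x st.2 a.1) else st.
have stepC : computable (fun p : X * (seq A * Y) => step p.1 p.2).
  rewrite /step; apply: (computable_opt (f := fun p a => (a.2, h p.1 p.2.2 a.1))).
  - exact/computable_uncons/computable_fst/computable_snd/computable_id.
  - apply: computable_pair; first exact/computable_snd/computable_snd/computable_id.
    apply: (computable_comp hC (g := fun p => (p.1.1, (p.1.2.2, p.2.1)))).
    apply: computable_pair; first exact/computable_fst/computable_fst/computable_id.
    apply: computable_pair.
      exact/computable_snd/computable_snd/computable_fst/computable_id.
    exact/computable_fst/computable_snd/computable_id.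
  - exact/computable_snd/computable_id.
(* By [size_code], the code of a list bounds its length; since [step] fixes the states whose list is
   empty, iterating too often is harmless. *)
have nC : computable (fun x => code (s x) : nat) by apply: computable_recode sC.
have := computable_snd (computable_iter nC (computable_pair sC zC) stepC).
apply: eq_computable => x; have := @size_code A cA (s x).
move: (code (s x)) => n; elim: n (s x) (z x) => [|n IHn] [|a l] y //= le_l; last first.
- by rewrite -iterS iterSr /= IHn.
- by rewrite -iterS iterSr /= (IHn [::]).
Qed.

End fold.

Section fold_right.
Context {X Y A : Type} {cX : coded X} {cY : coded Y} {cA : coded A}.

Lemma computable_rev (s : X -> seq A) : computable s -> computable (fun x => rev (s x)).
Proof.
move=> sC.
apply: (@eq_computable _ _ _ _ (fun x => foldl (fun y a => a :: y) [::] (s x))).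
  by move=> x; rewrite -[s x in LHS]revK foldl_rev; elim: (rev _) => //= a l ->.
apply: (computable_foldl (h := fun _ y a => a :: y)) => //.
  apply: computable_cons; first exact/computable_snd/computable_snd/computable_id.
  exact/computable_fst/computable_snd/computable_id.
exact: computable_cst.
Qed.

Lemma computable_foldr (h : X -> A -> Y -> Y) (z : X -> Y) (s : X -> seq A) :
  computable (fun p : X * (A * Y) => h p.1 p.2.1 p.2.2) ->
  computable z -> computable s -> computable (fun x => foldr (h x) (z x) (s x)).
Proof.
move=> hC zC sC.
have := computable_foldl (h := fun x y a => h x a y) _ zC (computable_rev sC).
move=> C; apply: eq_computable _ (C _) => [x|]; first by rewrite foldl_rev.
apply: (computable_comp hC (g := fun p => (p.1, (p.2.2, p.2.1)))).
apply: computable_pair; first exact/computable_fst/computable_id.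
apply: computable_pair; first exact/computable_snd/computable_snd/computable_id.
exact/computable_fst/computable_snd/computable_id.
Qed.

End fold_right.

Lemma computable_S X {cX : coded X} (n : X -> nat) :
  computable n -> computable (fun x => (n x).+1).
Proof. by move=> nC; have := computable_some nC; apply: computable_recode. Qed.

Lemma computable_pred X {cX : coded X} (n : X -> nat) :
  computable n -> computable (fun x => (n x).-1).
Proof.
by move=> [p pP]; exists (Comp prog_pred p) => x;
  exact: eval_Comp (pP x) (eval_pred _ _).
Qed.

Lemma computable_addn X {cX : coded X} (m n : X -> nat) :
  computable m -> computable n -> computable (fun x => m x + n x).
Proof.
move=> mC nC; apply: eq_computable _ (computable_iter (g := fun _ => succn) mC nC _) =>
  [x|]; first by rewrite iter_succn addnC.
exact/computable_S/computable_snd/computable_id.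
Qed.

Lemma computable_subn X {cX : coded X} (m n : X -> nat) :
  computable m -> computable n -> computable (fun x => m x - n x).
Proof.
move=> mC nC; apply: eq_computable _ (computable_iter (g := fun _ => predn) nC mC _) =>
  [x|].
  by elim: (n x) => [|k /= ->]; rewrite ?subn0 // subnS.
exact/computable_pred/computable_snd/computable_id.
Qed.

Lemma computable_muln X {cX : coded X} (m n : X -> nat) :
  computable m -> computable n -> computable (fun x => m x * n x).
Proof.
move=> mC nC; apply: eq_computable _
  (computable_iter (g := fun x => addn (n x)) mC (computable_cst 0) _) => [x|];
  first by rewrite iter_addn_0 mulnC.
apply: computable_addn; last exact/computable_snd/computable_id.
exact/(computable_comp nC)/computable_fst/computable_id.
Qed.

Lemma computable_expn X {cX : coded X} (k : nat) (n : X -> nat) :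
  computable n -> computable (fun x => k ^ n x).
Proof.
move=> nC; apply: eq_computable _
  (computable_iter (g := fun _ => muln k) nC (computable_cst 1) _) => [x|];
  first by rewrite iter_muln_1.
apply: computable_muln; last exact/computable_snd/computable_id.
exact: computable_cst.
Qed.

Lemma computable_neg X {cX : coded X} (b : X -> bool) :
  computable b -> computable (fun x => ~~ b x).
Proof.
move=> bC; apply: eq_computable _
  (computable_if bC (computable_cst false) (computable_cst true)).
by move=> x; case: (b x).
Qed.

Lemma computable_and X {cX : coded X} (b c : X -> bool) :
  computable b -> computable c -> computable (fun x => b x && c x).
Proof. by move=> bC cC; exact: (computable_if bC cC (computable_cst false)). Qed.

Lemma computable_or X {cX : coded X} (b c : X -> bool) :
  computable b -> computable c -> computable (fun x => b x || c x).
Proof. by move=> bC; exact: (computable_if bC (computable_cst true)). Qed.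

Lemma computable_implb X {cX : coded X} (b c : X -> bool) :
  computable b -> computable c -> computable (fun x => b x ==> c x).
Proof. by move=> bC cC; exact: (computable_if bC cC (computable_cst true)). Qed.

Lemma computable_leq X {cX : coded X} (m n : X -> nat) :
  computable m -> computable n -> computable (fun x => m x <= n x).
Proof.
move=> mC nC; have [p pP] := computable_subn mC nC.
have C : computable (fun x => 0 < m x - n x).
  by exists (Comp prog_gt0 p) => x; exact: eval_Comp (pP x) (eval_gt0 _ _).
by apply: eq_computable _ (computable_neg C) => x; rewrite subn_gt0 -leqNgt.
Qed.

Lemma computable_eqn X {cX : coded X} (m n : X -> nat) :
  computable m -> computable n -> computable (fun x => m x == n x).
Proof.
move=> mC nC; apply: eq_computable _
  (computable_and (computable_leq mC nC) (computable_leq nC mC)) => x.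
by rewrite eqn_leq.
Qed.

Lemma computable_all X A {cX : coded X} {cA : coded A} (P : X -> A -> bool)
    (s : X -> seq A) :
  computable (fun p : X * A => P p.1 p.2) -> computable s ->
  computable (fun x => all (P x) (s x)).
Proof.
move=> PC sC; apply: eq_computable _
  (computable_foldr (h := fun x a b => P x a && b) _ (computable_cst true) sC) => [x|];
  first by elim: (s x) => //= a l ->.
apply: computable_and; last exact/computable_snd/computable_snd/computable_id.
apply: (computable2 PC); first exact/computable_fst/computable_id.
exact/computable_fst/computable_snd/computable_id.
Qed.

Lemma computable_has X A {cX : coded X} {cA : coded A} (P : X -> A -> bool)
    (s : X -> seq A) :
  computable (fun p : X * A => P p.1 p.2) -> computable s ->
  computable (fun x => has (P x) (s x)).
Proof.
move=> PC sC; apply: eq_computable _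
  (computable_neg (computable_all (computable_neg PC) sC)) => x.
by rewrite -has_predC; apply: eq_has => a; exact: negbK.
Qed.

Lemma computable_size X A {cX : coded X} {cA : coded A} (s : X -> seq A) :
  computable s -> computable (fun x => size (s x)).
Proof.
move=> sC; apply: eq_computable _
  (computable_foldr (h := fun _ _ => succn) _ (computable_cst 0) sC) => [x|];
  first by elim: (s x) => //= a l ->.
exact/computable_S/computable_snd/computable_snd/computable_id.
Qed.

Lemma computable_nth X A {cX : coded X} {cA : coded A} (a : A) (s : X -> seq A)
    (n : X -> nat) :
  computable s -> computable n -> computable (fun x => nth a (s x) (n x)).
Proof.
move=> sC nC.
have C : computable (fun x => iter (n x)
  (fun l => if uncons l is Some c then c.2 else l) (s x)).
  apply: (computable_iter (g := fun _ l => if uncons l is Some c then c.2 else l)) => //.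
  apply: (computable_opt (f := fun _ c => c.2)); last exact/computable_snd/computable_id.
    exact/computable_uncons/computable_snd/computable_id.
  exact/computable_snd/computable_snd/computable_id.
apply: eq_computable _ (computable_opt (f := fun _ c => c.1) (computable_uncons C) _
  (computable_cst a)) => [x|]; last first.
  exact/computable_fst/computable_snd/computable_id.
elim: (n x) (s x) => [|k IHk] [|c l] //; rewrite iterSr [uncons _]/= IHk //.
by rewrite nth_nil.
Qed.

Definition below n : seq nat := nat_rect (fun=> seq nat) [::] cons n.

Lemma mem_below k n : (k \in below n) = (k < n).
Proof. by elim: n => //= n IHn; rewrite in_cons IHn ltnS [in RHS]leq_eqVlt. Qed.

Lemma computable_below X {cX : coded X} (n : X -> nat) :
  computable n -> computable (fun x => below (n x)).
Proof.
move=> nC; apply: (computable_rec (g := fun _ => cons) nC (computable_cst [::])).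
apply: computable_cons; first exact/computable_fst/computable_snd/computable_id.
exact/computable_snd/computable_snd/computable_id.
Qed.

Lemma computable_eq X (A : eqType) {cX : coded X} {cA : coded A} (a b : X -> A) :
  computable a -> computable b -> computable (fun x => a x == b x).
Proof.
move=> aC bC.
have rec (f : X -> A) : computable f -> computable (fun x => code (f x) : nat).
  by apply: computable_recode.
apply: eq_computable _ (computable_eqn (rec _ aC) (rec _ bC)) => x;
  apply/eqP/eqP => [|->//]; exact: code_inj.
Qed.

Lemma computable_mem X (A : eqType) {cX : coded X} {cA : coded A} (a : X -> A)
    (s : X -> seq A) :
  computable a -> computable s -> computable (fun x => a x \in s x).
Proof.
move=> aC sC.
apply: eq_computable _ (computable_has (P := fun x b => b == a x) _ sC) => [x|];
  first by rewrite has_pred1.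
apply: computable_eq; first exact/computable_snd/computable_id.
exact/(computable_comp aC)/computable_fst/computable_id.
Qed.

Lemma computable_prefix X (A : eqType) {cX : coded X} {cA : coded A} (s t : X -> seq A) :
  computable s -> computable t -> computable (fun x => prefix (s x) (t x)).
Proof.
move=> sC tC.
pose st x := foldl (fun (u : bool * seq A) a =>
  if uncons u.2 is Some c then (u.1 && (c.1 == a), c.2) else (false, [::])) (true, t x)
    (s x).
have C : computable st.
  apply: (computable_foldl (h := fun _ u a => if uncons u.2 is Some c then
    (u.1 && (c.1 == a), c.2) else (false, [::]))) => //.
    apply: (computable_opt (f := fun p c => (p.2.1.1 && (c.1 == p.2.2), c.2)));
      last exact: computable_cst.
      exact/computable_uncons/computable_snd/computable_fst/computable_snd/computable_id.
    apply: computable_pair; last exact/computable_snd/computable_snd/computable_id.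
    apply: computable_and.
      exact/computable_fst/computable_fst/computable_snd/computable_fst/computable_id.
    apply: computable_eq; first exact/computable_fst/computable_snd/computable_id.
    exact/computable_snd/computable_snd/computable_fst/computable_id.
  by apply: computable_pair tC; exact: computable_cst.
apply: eq_computable _ (computable_fst C) => x; rewrite /st.
have F (l l' : seq A) : (foldl
  (fun u a => if uncons u.2 is Some c then (u.1 && (c.1 == a), c.2)
    else (false, [::])) (false, l') l).1 = false.
  by elim: l l' => //= a l IHl [|c l'] /=; rewrite IHl.
elim: (s x) (t x) => [|a l IHl] [|c l'] //=.
by rewrite [a == c]eq_sym; case: (c == a) => /=; rewrite ?IHl ?F.
Qed.

Lemma computable_unpair X {cX : coded X} (n : X -> nat) :
  computable n -> computable (fun x => unpair (n x)).
Proof. by apply: computable_recode => x; rewrite /= unpairK. Qed.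

Lemma computable_pairing X {cX : coded X} (m n : X -> nat) :
  computable m -> computable n -> computable (fun x => pairing (m x) (n x)).
Proof. by move=> mC nC; have := computable_pair mC nC; apply: computable_recode. Qed.

End computable.

Ltac computable_step :=
  first [ assumption | apply: computable_id | exact: computable_cst
        | lazymatch goal with
          | |- computable _ (fun x => (_, _)) => apply: computable_pair
          | |- computable _ (fun x => fst _) => apply: computable_fst
          | |- computable _ (fun x => snd _) => apply: computable_snd
          | |- computable _ fst => exact: computable_fst (computable_id _)
          | |- computable _ snd => exact: computable_snd (computable_id _)
          | |- computable _ (fun x => Some _) => apply: computable_some
          | |- computable _ (fun x => _ :: _) => apply: computable_cons
          | |- computable _ (fun x => if _ then _ else _) => apply: computable_if
          | |- computable _ (fun x => _.+1) => apply: computable_S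
          | |- computable _ (fun x => _.-1) => apply: computable_pred
          | |- computable _ (fun x => _ + _) => apply: computable_addn
          | |- computable _ (fun x => _ - _) => apply: computable_subn
          | |- computable _ (fun x => _ * _) => apply: computable_muln
          | |- computable _ (fun x => _ ^ _) => apply: computable_expn
          | |- computable _ (fun x => ~~ _) => apply: computable_neg
          | |- computable _ (fun x => _ && _) => apply: computable_and
          | |- computable _ (fun x => _ || _) => apply: computable_or
          | |- computable _ (fun x => _ ==> _) => apply: computable_implb
          | |- computable _ (fun x => _ <= _) => apply: computable_leq
          | |- computable _ (fun x => _ == _) => apply: computable_eq
          | |- computable _ (fun x => _ \in _) => apply: computable_mem
          | |- computable _ (fun x => prefix _ _) => apply: computable_prefix
          | |- computable _ (fun x => unpair _) => apply: computable_unpair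
          | |- computable _ unpair => apply: computable_unpair
          | |- computable _ (fun x => pairing _ _) => apply: computable_pairing
          | |- computable _ (fun x => size _) => apply: computable_size
          | |- computable _ (fun x => nth _ _ _) => apply: computable_nth
          | |- computable _ (fun x => below _) => apply: computable_below
          | |- computable _ (fun x => all _ _) => apply: computable_all
          | |- computable _ (fun x => has _ _) => apply: computable_has
          end ].
Ltac computability := cbn beta; repeat (computable_step; cbn beta).

(** * Types whose codes form a decidable set *)

Class decodable X {cX : coded X} : Prop :=
  decodableP : forall o, computable o (fun n => `[< exists x : X, code x = n >]).
Arguments decodable X {cX}.

Definition decode X {cX : coded X} (n : nat) : option X :=
  if pselect (exists x : X, code x = n) is left e then Some (projT1 (cid e)) else None.

Lemma codeK X {cX : coded X} (x : X) : decode (code x) = Some x.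
Proof.
rewrite /decode; case: pselect => [e|[]]; last by exists x.
by congr Some; apply: code_inj; case: (cid e).
Qed.

Lemma decodeK X {cX : coded X} n (x : X) : decode n = Some x -> code x = n.
Proof. by rewrite /decode; case: pselect => // e [<-]; case: (cid e). Qed.

Lemma computable_valid o X Y {cX : coded X} {cY : coded Y} {dY : decodable Y}
    (n : X -> nat) :
  computable o n -> computable o (fun x => `[< exists y : Y, code y = n x >]).
Proof. by move=> nC; exact: (computable_comp (@decodableP Y _ dY o) nC). Qed.

(** [decode] picks a preimage by choice, but its value has code [n.+1] or 0, so a test of whether
    [n] is a code suffices to compute it. *)
Lemma computable_decode o X Y {cX : coded X} {cY : coded Y} {dY : decodable Y}
    (n : X -> nat) :
  computable o n -> computable o (fun x => decode (n x) : option Y).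
Proof.
move=> nC.
have C : computable o (fun x => if `[< exists y : Y, code y = n x >] then (n x).+1 else 0).
  by apply: computable_if; [exact: computable_valid|computability..].
apply: computable_recode C => x; rewrite /= /decode; case: pselect => [e|ne].
  by rewrite asboolT //; case: (cid e) => y /= ->.
by rewrite asboolF.
Qed.

#[export] Instance nat_decodable : decodable nat.
Proof.
move=> o; apply: eq_computable _ (computable_cst o true) => n.
by apply/esym/asboolT; exists n.
Qed.

#[export] Instance bool_decodable : decodable bool.
Proof.
move=> o; apply: (@eq_computable _ _ _ _ _ (fun n => n <= 1)); last by computability.
move=> n; apply/idP/asboolP => [|[[] <-] //].
by case: n => [|[|]] // _; [exists false|exists true].
Qed.

#[export] Instance pair_decodable X Y {cX : coded X} {cY : coded Y}
  {dX : decodable X} {dY : decodable Y} : decodable (X * Y).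
Proof.
move=> o; apply: (@eq_computable _ _ _ _ _
  (fun n => `[< exists x : X, code x = (unpair n).1 >]
                   && `[< exists y : Y, code y = (unpair n).2 >])); last first.
  by apply: computable_and; apply: computable_valid; computability.
move=> n; apply/andP/asboolP => [[/asboolP[x ex] /asboolP[y ey]]|[[x y] <-]].
  by exists (x, y); rewrite /= ex ey unpairK.
by rewrite /= pairingK; split; apply/asboolP; [exists x|exists y].
Qed.

(** Every number can be read as a list of numbers, so that being the code of a list over [X] is
    checked entry by entry. *)
Lemma code_seq_surj n : exists s : seq nat, code s = n.
Proof.
have [m] := ubnP n; elim: m n => // m IHm [|n] lt_nm; first by exists [::].
have [|s es] := IHm (unpair n).2.
  by rewrite -ltnS (leq_trans _ lt_nm)// ltnS -{2}(unpairK n) ltnS leq_pairingr.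
by exists ((unpair n).1 :: s); rewrite code_cons es unpairK.
Qed.

#[export] Instance seq_decodable X {cX : coded X} {dX : decodable X} : decodable (seq X).
Proof.
(* [s] inverts the coding, so the identity program computes it. *)
move=> o; pose s n : seq nat := projT1 (cid (code_seq_surj n)).
have sK n : code (s n) = n := projT2 (cid (code_seq_surj n)).
have sC : computable o s by apply: computable_recode (computable_id o) => n; rewrite sK.
have C : computable o (fun n => all (fun k => `[< exists x : X, code x = k >]) (s n)).
  by apply: computable_all => //; apply: computable_valid; computability.
apply: eq_computable _ C => n; rewrite -{2}(sK n).
elim: (s n) => [|k l IHl] /=; first by apply/esym/asboolT; exists [::].
rewrite {}IHl; apply/andP/asboolP => [[/asboolP[x <-] /asboolP[t et]]|].
  by exists (x :: t); move: et => /= ->.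
move=> [[|x t] //= [/pairing_inj[ex et]]]; split; apply/asboolP; first by exists x.
by exists t.
Qed.

(** * Recursively enumerable relations *)

Section RE.
Variable o : nat -> nat.

(** The search relation [T] is exposed because trimming uses it as the clock of an enumeration. *)
Definition RE X {cX : coded X} (S : X -> Prop) : Prop :=
  exists2 T : X -> nat -> bool, computable o (fun p => T p.1 p.2) &
    forall x, S x <-> exists k, T x k.

Section closure.
Context {X Y : Type} {cX : coded X} {cY : coded Y} {dY : decodable Y}.
Implicit Types S : X -> Prop.

Lemma eq_RE S S' : (forall x, S x <-> S' x) -> RE S -> RE S'.
Proof. by move=> SS' [T TC TP]; exists T => // x; rewrite -SS'. Qed.

Lemma RE_dec (b : X -> bool) : computable o b -> RE (fun x => b x).
Proof.
move=> bC; exists (fun x _ => b x); last by move=> x; split=> [bx|[]//]; exists 0.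
by apply: computable_comp bC _; computability.
Qed.

Lemma RE_comp (S : Y -> Prop) (f : X -> Y) :
  RE S -> computable o f -> RE (fun x => S (f x)).
Proof.
move=> [T TC TP] fC; exists (fun x => T (f x)) => //.
by apply: computable2 TC _ _; computability; apply: computable_comp fC _; computability.
Qed.

Lemma RE_and S S' : RE S -> RE S' -> RE (fun x => S x /\ S' x).
Proof.
move=> [T TC TP] [T' TC' TP'].
exists (fun x k => T x (unpair k).1 && T' x (unpair k).2).
  by computability; [apply: computable2 TC _ _|apply: computable2 TC' _ _]; computability.
move=> x; rewrite TP TP'; split=> [[[k Tk] [l Tl]]|[k /andP[Tk Tl]]].
  by exists (pairing k l); rewrite pairingK Tk.
by split; [exists (unpair k).1|exists (unpair k).2].
Qed.

Lemma RE_or S S' : RE S -> RE S' -> RE (fun x => S x \/ S' x).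
Proof.
move=> [T TC TP] [T' TC' TP']; exists (fun x k => T x k || T' x k).
  by computability.
move=> x; rewrite TP TP'; split=> [[[k Tk]|[k Tk]]|[k /orP[Tk|Tk]]].
- by exists k; rewrite Tk.
- by exists k; rewrite Tk orbT.
- by left; exists k.
- by right; exists k.
Qed.

(** The candidate and its search time are packed in one number; numbers that code no [y] must be
    rejected, whence [decodable Y]. *)
Lemma RE_ex (S : X -> Y -> Prop) :
  RE (fun p => S p.1 p.2) -> RE (fun x => exists y, S x y).
Proof.
move=> [T TC TP].
exists (fun x k => if (decode (unpair k).1 : option Y) is Some y then T (x, y)
  (unpair k).2 else false).
  apply: (computable_opt (f := fun p y => T (p.1, y) (unpair p.2).2));
    last by computability.
    by apply: computable_decode; computability.
  by apply: computable2 TC _ _; computability.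
move=> x; split=> [[y /(TP (x, y))[k Tk]]|[k]].
  by exists (pairing (code y) k); rewrite pairingK codeK.
case: (decode _) => // y Tk; exists y; apply/(TP (x, y)); by exists (unpair k).2.
Qed.

End closure.

(** The list being finite, one bound [K] serves the searches for all its elements. *)
Lemma RE_all X (A : eqType) {cX : coded X} {cA : coded A} (S : X -> A -> Prop)
    (s : X -> seq A) :
  RE (fun p => S p.1 p.2) -> computable o s -> RE (fun x => forall a, a \in s x -> S x a).
Proof.
move=> [T TC TP] sC.
exists (fun x K => all (fun a => has (T (x, a)) (below K)) (s x)).
  by computability; [apply: computable2 TC _ _|apply: computable_comp sC _]; computability.
move=> x; split=> [Sx|[K /allP TK] a /TK/hasP[k _ Tk]]; last by apply/(TP (x, a)); exists k.
elim: (s x) Sx => [|a l IHl] Sx; first by exists 0.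
have [|K /allP TK] := IHl; first by move=> b bl; apply: Sx; rewrite in_cons bl orbT.
have /(TP (x, a))[k Tk] := Sx a (mem_head _ _).
exists (maxn K k.+1); apply/allP => b; rewrite in_cons => /orP[/eqP->|/TK/hasP[j jK Tj]].
  by apply/hasP; exists k => //; rewrite mem_below leq_maxr.
by apply/hasP; exists j => //; move: jK; rewrite !mem_below leq_max => ->.
Qed.

Lemma RE_all_lt X {cX : coded X} (S : X -> nat -> Prop) (n : X -> nat) :
  RE (fun p => S p.1 p.2) -> computable o n -> RE (fun x => forall k, k < n x -> S x k).
Proof.
move=> SR nC; apply: eq_RE (RE_all SR (computable_below nC)) => x.
by split=> SX k; have := SX k; rewrite mem_below.
Qed.

Lemma RE_eq X (A : eqType) {cX : coded X} {cA : coded A} (a b : X -> A) :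
  computable o a -> computable o b -> RE (fun x => a x = b x).
Proof.
move=> aC bC; apply: (@eq_RE _ _ (fun x => a x == b x)) => [x|].
  by split=> /eqP.
by apply: RE_dec; computability.
Qed.

Lemma RE_comp3 X Y Z W {cX : coded X} {cY : coded Y} {cZ : coded Z} {cW : coded W}
    (S : Y -> Z -> W -> Prop) (f : X -> Y) (g : X -> Z) (h : X -> W) :
  RE (fun x => S x.1 x.2.1 x.2.2) -> computable o f -> computable o g -> computable o h ->
  RE (fun x => S (f x) (g x) (h x)).
Proof.
move=> SR fC gC hC.
by apply: (RE_comp (S := fun x => S x.1 x.2.1 x.2.2)
  (f := fun x => (f x, (g x, h x))) SR); computability.
Qed.

(** The oracle relation need only be enumerable, so the lemma can be iterated, the outputs of one
    program serving as oracle to another. *)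
Lemma RE_sem X {cX : coded X} (rho : X -> nat -> nat -> Prop) (p : program) :
  RE (fun x => rho x.1 x.2.1 x.2.2) -> RE (fun x => sem (rho x.1) p x.2.1 x.2.2).
Proof.
move=> rhoR; elim: p => //=; try by apply: RE_eq; computability.
- move=> p IHp q IHq; apply: RE_and.
    by apply: (RE_comp3 (S := fun x => sem (rho x) p)); computability.
  by apply: (RE_comp3 (S := fun x => sem (rho x) q)); computability.
- move=> p IHp q IHq; apply: RE_ex; apply: RE_and.
    by apply: (RE_comp3 (S := fun x => sem (rho x) q)); computability.
  by apply: (RE_comp3 (S := fun x => sem (rho x) p)); computability.
- move=> p IHp q IHq; apply: RE_ex.
  pose A (x : (X * (nat * nat)) * seq nat) := sem (rho x.1.1) p (unpair x.1.2.1).1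
    (nth 0 x.2 0).
  pose B (x : (X * (nat * nat)) * seq nat) := forall j, j < (unpair x.1.2.1).2 ->
    sem (rho x.1.1) q (pairing (unpair x.1.2.1).1 (pairing j (nth 0 x.2 j)))
      (nth 0 x.2 j.+1).
  apply: (@eq_RE _ _ (fun x => A x /\ B x /\ nth 0 x.2 (unpair x.1.2.1).2 = x.1.2.2)).
    by move=> x; split=> [[? []]|[]].
  apply: RE_and; first by apply: (RE_comp3 (S := fun x => sem (rho x) p)); computability.
  apply: RE_and; last by apply: RE_eq; computability.
  apply: RE_all_lt; last by computability.
  by apply: (RE_comp3 (S := fun x => sem (rho x) q)); computability.
- move=> p IHp; apply: RE_and.
    apply: RE_all_lt; last by computability.
    by apply: RE_ex; apply: (RE_comp3 (S := fun x => sem (rho x) p)); computability.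
  by apply: (RE_comp3 (S := fun x => sem (rho x) p)); computability.
Qed.

Lemma RE_eval p : RE (fun x : nat * nat => eval o p x.1 x.2).
Proof.
have oR : RE (fun x : bool * (nat * nat) => graph o x.2.1 x.2.2).
  apply: RE_eq; last by computability.
  by exists (Comp Query (Comp Fst Snd)) => x; apply: eval_Comp (eval_Query _ _);
    apply: eval_Comp (eval_Snd _ _ _) (eval_Fst _ _ _).
apply: (@eq_RE _ _ (fun x => sem (graph o) p x.1 x.2)) => [x|]; first by rewrite evalP.
exact: (RE_comp3 (S := fun _ => _) (f := fun _ => true)
  (RE_sem (rho := fun _ => graph o) p oR) (computable_cst _ _)
  (computable_fst (computable_id _)) (computable_snd (computable_id _))).
Qed.

Lemma RE_enumerated X Y {cX : coded X} {cY : coded Y} {dY : decodable Y}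
    (S : X -> Y -> Prop) :
  RE (fun x => S x.1 x.2) ->
  exists p, forall x, enumerated code o p (code x) = [set y | S x y]%classic.
Proof.
move=> [T TC TP].
pose f (x : X * nat) : option Y :=
  if @decode Y cY (unpair x.2).1 is Some y then
    if T (x.1, y) (unpair x.2).2 then Some y else None
  else None.
have fC : computable o f.
  rewrite /f; apply: (computable_opt
    (f := fun (x : X * nat) (y : Y) => if T (x.1, y)
    (unpair x.2).2 then Some y else None)).
  - by apply: computable_decode; computability.
  - by computability; apply: computable2 TC _ _; computability.
  - by computability.
case: fC => q qP.
pose is0 := prog_if prog_gt0 Zero (prog_const 1).
have is0P n : eval o is0 n (n == 0).
  have := eval_gt0 o n; case: n => [|n] n0; first exact: eval_if0 n0 (eval_const _ _ _).
  by apply: eval_if1 n0 (eval_const _ _ _) _; constructor.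
(* [loop] halts exactly on nonzero inputs. It makes the program diverge when [f] returns [None], of
   code 0; a default output might code an object outside [S x]. *)
pose loop := Mu (Comp is0 Fst).
have loopP n m : eval o loop n m -> 0 < n.
  case: n => // /eval_MuE h.
  by have := eval_fun h (eval_Comp (eval_Fst _ _ _) (is0P _)).
exists (Comp (Comp Fst (Pair prog_pred loop)) q) => x; apply/seteqP; split=> y /=;
  last first.
  move=> /(TP (x, y))[k Tk]; exists (pairing (code y) k).
  apply: eval_Comp (qP (x, pairing (code y) k)) _.
  rewrite /f /= pairingK codeK Tk.
  apply: eval_Comp (eval_Fst _ _ 0); apply: eval_Pair; first exact: eval_pred.
  apply: (eval_Mu (f := fun=> 0)) => //.
  exact: eval_Comp (eval_Fst _ _ _) (is0P _).
move=> [k /eval_CompE[n qn /eval_CompE[m /eval_PairE[pm lm] ey]]].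
have {}ey := eval_fun ey (eval_fst _ _).
have := eval_fun qn (qP (x, k)); rewrite /f /=.
have n0 := loopP _ _ lm.
case: (decode _) => [z|]; last by move=> n_0; rewrite n_0 in n0.
case: ifP => [Tz e|_ n_0]; last by rewrite n_0 in n0.
have -> : y = z by apply: code_inj; rewrite ey (eval_fun pm (eval_pred o n)) e.
by apply/(TP (x, z)); exists (unpair k).2.
Qed.

End RE.

Import Order.TTheory GRing.Theory Num.Theory.

(** * Rational numbers *)

Lemma code_rat_inj : injective code_rat.
Proof.
move=> q q' /pairing_inj[/pairing_inj[/bool_code_inj s_eq n_eq] d_eq].
have {}d_eq : denq q = denq q'.
  by rewrite -[denq q]gez0_abs // -[denq q']gez0_abs // d_eq.
have {}n_eq : numq q = numq q'.
  by rewrite [numq q]intEsign [numq q']intEsign s_eq n_eq.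
by rewrite -(divq_num_den q) n_eq d_eq divq_num_den.
Qed.

#[export] Instance rat_coded :
  coded rat := {| code := code_rat; code_inj := code_rat_inj |}.

(** Splitting the numerator by sign keeps comparisons of rationals within the natural numbers. *)
Definition num_pos (q : rat) : nat := if (numq q < 0)%R then 0 else `|numq q|%N.
Definition num_neg (q : rat) : nat := if (numq q < 0)%R then `|numq q|%N else 0.
Definition den (q : rat) : nat := `|denq q|%N.

Lemma den_gt0 q : 0 < den q.
Proof. by rewrite absz_gt0 denq_neq0. Qed.

Lemma ratE (q : rat) : (q = ((num_pos q)%:R - (num_neg q)%:R) / (den q)%:R)%R.
Proof.
rewrite -[LHS]divq_num_den /num_pos /num_neg /den; congr (_ / _)%R; last first.
  by rewrite natr_absz normr_denq.
case: ltP => [n_lt0|n_ge0]; rewrite natr_absz ?sub0r ?subr0.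
  by rewrite ltr0_norm // mulrNz opprK.
by rewrite ger0_norm.
Qed.

Section rational.
Context {o : nat -> nat} {X : Type} {cX : coded X}.
Implicit Types a b c d : X -> rat.

Lemma computable_num_den a : computable o a ->
  [/\ computable o (fun x => num_pos (a x)), computable o (fun x => num_neg (a x)) &
      computable o (fun x => den (a x))].
Proof.
move=> aC.
have C : computable o (fun x => (((numq (a x) < 0)%R, `|numq (a x)|%N), den (a x))).
  by apply: computable_recode aC.
split; last exact: computable_snd C.
  exact: computable_if (computable_fst (computable_fst C)) (computable_cst _ 0)
    (computable_snd (computable_fst C)).
exact: computable_if (computable_fst (computable_fst C)) (computable_snd (computable_fst C))
    (computable_cst _ 0).
Qed.

(** The comparisons below derive from this one. Codes of sums, which would require reducing
    fractions, are never computed: the inequality is cleared of denominators and subtractions. *)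
Lemma computable_le_add a b c d :
  computable o a -> computable o b -> computable o c -> computable o d ->
  computable o (fun x => (a x + b x <= c x + d x)%R).
Proof.
move=> /computable_num_den[? ? ?] /computable_num_den[? ? ?].
move=> /computable_num_den[? ? ?] /computable_num_den[? ? ?].
apply: (@eq_computable _ _ _ _ _ (fun x =>
    (num_pos (a x) * den (b x) + num_pos (b x) * den (a x)) * (den (c x) * den (d x)) +
    (num_neg (c x) * den (d x) + num_neg (d x) * den (c x)) * (den (a x) * den (b x)) <=
    (num_neg (a x) * den (b x) + num_neg (b x) * den (a x)) * (den (c x) * den (d x)) +
    (num_pos (c x) * den (d x) + num_pos (d x) * den (c x)) *
      (den (a x) * den (b x)))); last first.
  by computability.
move=> x.
have := (den_gt0 (a x), den_gt0 (b x), den_gt0 (c x), den_gt0 (d x)).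
rewrite [in RHS](ratE (a x)) [in RHS](ratE (b x)) [in RHS](ratE (c x)) [in RHS](ratE (d x)).
move: (num_pos _) (num_neg _) (den _) (num_pos _) (num_neg _) (den _)
  (num_pos _) (num_neg _) (den _) (num_pos _) (num_neg _) (den _).
move=> pa ma da pb mb db pc mc dc pd md dd [[[da0 db0] dc0] dd0].
have dne n : 0 < n -> (n%:R != 0 :> rat)%R by rewrite pnatr_eq0 lt0n.
have D0 : (0 < da%:R * db%:R * (dc%:R * dd%:R) :> rat)%R.
  by rewrite !mulr_gt0 ?ltr0n.
rewrite -(ler_pM2r D0) -(ler_nat rat) -subr_ge0 -[in RHS]subr_ge0; congr (0 <= _)%R.
rewrite !(natrD, natrM); field.
by rewrite !dne.
Qed.

Lemma computable_ltq a b :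
  computable o a -> computable o b -> computable o (fun x => (a x < b x)%R).
Proof.
move=> aC bC; apply: eq_computable _
  (computable_neg (computable_le_add bC (computable_cst _ 0%R) aC
  (computable_cst _ 0%R))).
by move=> x; rewrite /= !addr0 -ltNge.
Qed.

Lemma computable_leq_add a b c :
  computable o a -> computable o b -> computable o c ->
  computable o (fun x => (a x + b x <= c x)%R).
Proof.
move=> aC bC cC; apply: eq_computable _ (computable_le_add aC bC cC (computable_cst _ 0%R)).
by move=> x; rewrite /= addr0.
Qed.

Lemma computable_geq_add a b c :
  computable o a -> computable o b -> computable o c ->
  computable o (fun x => (c x <= a x + b x)%R).
Proof.
move=> aC bC cC; apply: eq_computable _ (computable_le_add cC (computable_cst _ 0%R) aC bC).
by move=> x; rewrite /= addr0.
Qed.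

Lemma computable_add_lt a b c :
  computable o a -> computable o b -> computable o c ->
  computable o (fun x => (a x + b x < c x)%R).
Proof.
move=> aC bC cC; apply: eq_computable _ (computable_neg (computable_geq_add aC bC cC)).
by move=> x; rewrite -ltNge.
Qed.

Lemma computable_natq (n : X -> nat) :
  computable o n -> computable o (fun x => (n x)%:R%R : rat).
Proof.
move=> nC.
have C : computable o (fun x => ((false, n x), 1)) by computability.
by apply: computable_recode C => x;
  rewrite /= /code_rat -[(n x)%:R%R]/((Posz (n x))%:~R)%R numq_int denq_int.
Qed.

Lemma computable_invS (n : X -> nat) :
  computable o n -> computable o (fun x => (n x).+1%:R^-1%R : rat).
Proof.
move=> nC.
have C : computable o (fun x => ((false, 1), (n x).+1)) by computability.
apply: computable_recode C => x; rewrite /= /code_rat.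
have -> : ((n x).+1%:R^-1 = 1%:Q / (Posz (n x).+1)%:Q :> rat)%R by rewrite div1r.
by rewrite coprimeq_num ?coprimeq_den ?coprime1n // gtr0_sg.
Qed.

(** Codes of rationals are reduced fractions, so recognizing a code involves this test, done by
    trying all divisors up to [n x]. *)
Lemma computable_coprime (m n : X -> nat) : computable o m -> computable o n ->
  computable o (fun x => (0 < n x) && coprime (m x) (n x)).
Proof.
move=> mC nC.
pose dvd e k := has (fun j => k == j * e) (below k.+1).
have dvdP e k : 0 < k -> dvd e k = (e %| k).
  move=> k0; apply/hasP/dvdnP => [[j _ /eqP ->]|[j ekj]]; first by exists j.
  exists j; last by rewrite ekj.
  rewrite mem_below ltnS ekj leq_pmulr //; by move: k0; rewrite ekj muln_gt0 => /andP[].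
apply: (@eq_computable _ _ _ _ _ (fun x => (0 < n x) && all (fun e =>
  [|| m x == 0 | dvd e (m x)] && dvd e (n x) ==> (e == 1)) (below (n x).+1))); last first.
  by rewrite /dvd; computability;
    first [apply: (computable_comp mC)|apply: (computable_comp nC)]; computability.
move=> x; case: (posnP (n x)) => [//|n0]; rewrite !andTb; apply/allP/idP => [h|cop e].
  have := h (gcdn (m x) (n x)); rewrite mem_below ltnS dvdn_leq ?dvdn_gcdr //.
  move=> /(_ isT)/implyP; rewrite (dvdP _ (n x)) // dvdn_gcdr andbT; apply.
  by case: posnP => // m0; rewrite dvdP // dvdn_gcdl.
rewrite mem_below ltnS (dvdP _ (n x)) // => _; apply/implyP => /andP[em en].
suff : e %| gcdn (m x) (n x) by rewrite (eqP cop) dvdn1.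
rewrite dvdn_gcd en andbT; move: em; case: posnP => [->|m0] //=.
by rewrite dvdP.
Qed.

End rational.

#[export] Instance rat_decodable : decodable rat.
Proof.
move=> o.
apply: (@eq_computable _ _ _ _ _ (fun n =>
  let s := (unpair (unpair n).1).1 in let a := (unpair (unpair n).1).2 in
  let d := (unpair n).2 in
  (* Zero carries only the nonnegative sign, hence [0 < a] when the sign bit is 1. *)
  [&& s <= 1, (s == 1) ==> (0 < a) & (0 < d) && coprime a d])); last first.
  cbv zeta; apply: computable_and; first by computability.
  by apply: computable_and; [|apply: computable_coprime]; computability.
move=> n /=; apply/and3P/asboolP => [|[q <-]] /=; last first.
  rewrite /code_rat !pairingK /= coprime_num_den -/(den q) den_gt0; split=> //.
    by case: (numq q < 0)%R.
  by rewrite absz_gt0; case: (ltgtP (numq q)).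
have : pairing (pairing (unpair (unpair n).1).1 (unpair (unpair n).1).2) (unpair n).2 = n.
  by rewrite !unpairK.
move: (unpair (unpair n).1).1 (unpair (unpair n).1).2 (unpair n).2 => s a d <-.
move=> [s1 sa /andP[d0 cop]].
exists ((-1) ^+ s * (Posz a)%:Q / (Posz d)%:Q)%R.
have cop' : coprime `|((-1) ^+ s * Posz a)%R| `|Posz d| by rewrite abszMsign.
have d1 : (0 < Posz d)%R by rewrite ltz_nat.
have -> : ((-1) ^+ s * (Posz a)%:Q = ((-1) ^+ s * Posz a)%R%:Q :> rat)%R.
  by rewrite rmorphM /= rmorphXn rmorphN1.
rewrite /code_rat coprimeq_num // coprimeq_den // gt_eqF // gtr0_sg // mul1r abszMsign.
congr (pairing (pairing _ _) _); move: s s1 sa {cop'} => [|[|//]] _ /=.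
  by [].
by move=> a0; rewrite expr1 mulN1r oppr_lt0 ltz_nat a0.
Qed.

(** * Trimming *)

#[export] Instance condition_coded : coded condition :=
  pair_coded (pair_coded (seq_coded bool_coded) rat_coded) rat_coded.
#[export] Instance condition_decodable : decodable condition.
Proof. exact: pair_decodable. Qed.

Lemma computable_pmap o X A B {cX : coded X} {cA : coded A} {cB : coded B}
    (f : X -> A -> option B) (s : X -> seq A) :
  computable o (fun p : X * A => f p.1 p.2) -> computable o s ->
  computable o (fun x => pmap (f x) (s x)).
Proof.
move=> fC sC.
apply: eq_computable _ (computable_foldr
  (h := fun x a l => if f x a is Some b then b :: l else l) _
  (computable_cst _ [::]) sC) => [x|].
  by elim: (s x) => //= a l ->; case: (f x a).
apply: (computable_opt (f := fun (p : X * (A * seq B)) b => b :: p.2.2)); computability.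
by apply: (computable2 fC); computability.
Qed.

Section trim.
Variable T : nat * (seq bool * seq condition) -> nat -> bool.
Hypothesis TC : computable no_oracle (fun p => T p.1 p.2).

(** One number codes both a candidate and the search step at which [T] accepts it, so the stages are
    finite lists that increase to the enumerated set. *)
Definition found_at (i j : nat) : option (seq bool * seq condition) :=
  if decode j : option (seq bool * seq condition * nat) is Some z then
    if T (i, z.1) z.2 then Some z.1 else None
  else None.

Definition stage (i k : nat) :
  seq (seq bool * seq condition) := pmap (found_at i) (below k).

Lemma mem_stage i k z : reflect (exists2 j, j < k & found_at i j = Some z)
  (z \in stage i k).
Proof.
rewrite /stage mem_pmap; apply: (iffP mapP) => -[j].
  by rewrite mem_below => lt_j ->; exists j.
by move=> lt_j zj; exists j; rewrite ?mem_below.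
Qed.

Lemma stage_le i k k' : k <= k' -> {subset stage i k <= stage i k'}.
Proof.
move=> le_k z /mem_stage[j lt_j zj]; apply/mem_stage; exists j => //.
exact: leq_trans le_k.
Qed.

Lemma stage_ex i z : (exists k, z \in stage i k) <-> exists s, T (i, z) s.
Proof.
split=> [[k /mem_stage[j _]]|[s Tz]].
  by rewrite /found_at; case: decode => // -[z' s]; case: ifP => //= Tz [<-]; exists s.
exists (code (z, s)).+1; apply/mem_stage; exists (code (z, s)) => //.
by rewrite /found_at codeK /= Tz.
Qed.

Definition margin (k : nat) : rat := (k.+1%:R^-1)%R.

(* gamma forces the conditions of beta, with all intervals shrunk by [margin k]
   on both sides; [refutes] means that gamma excludes them, even when the shrunk
   intervals are closed. *)
Definition implies_within (k : nat) (gamma beta : seq condition) : bool :=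
  all (fun c => has (fun g => [&& g.1.1 == c.1.1, (c.1.2 + margin k <= g.1.2)%R &
    (g.2 + margin k <= c.2)%R]) gamma) beta.

Definition refutes (k : nat) (gamma beta : seq condition) : bool :=
  has (fun c => has (fun g => (g.1.1 == c.1.1) && ((g.2 <= c.1.2 + margin k)%R ||
    (c.2 <= g.1.2 + margin k)%R)) gamma) beta.

(* Each element of H is a condition u < P(y) < v and a numerator a such that
   v <= a / (d + 1); the sum of these fractions is at most 4 ^ -i. *)
Definition small_cover (i d : nat) (gamma : seq condition)
    (H : seq (condition * nat)) : bool :=
  all (fun h => (h.1 \in gamma) &&
    (num_pos h.1.2 * d.+1 <= h.2 * den h.1.2 + num_neg h.1.2 * d.+1)) H &&
  (foldr (fun h n => h.2 + n) 0 H * 4 ^ i <= d.+1).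

Definition covers (i k : nat) (gamma : seq condition) (H : seq (condition * nat)) : bool :=
  all (fun z => has (fun h => prefix h.1.1.1 z.1) H || refutes k gamma z.2) (stage i k).

(* The conditions in H, which cover every interval of the stage that gamma does
   not rule out, bound the measure of the stage set of every measure satisfying
   gamma. *)
Definition trimmed (i : nat) (z : seq bool * seq condition) : Prop :=
  exists k beta H d, [&& (z.1, beta) \in stage i k, implies_within k z.2 beta,
    small_cover i d z.2 H & covers i k z.2 H].

Section computable.
Context {X : Type} {cX : coded X}.
Notation computable := (computable no_oracle).
Implicit Types (i k d : X -> nat) (beta gamma : X -> seq condition).

Lemma computable_stage i k :
  computable i -> computable k -> computable (fun x => stage (i x) (k x)).
Proof.
move=> iC kC; apply: computable_pmap; last by computability.
rewrite /found_at.
apply: (computable_opt (f := fun p z => if T (i p.1, z.1) z.2 then Some z.1 else None)).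
- by apply: computable_decode; computability.
- computability; apply: (computable2 TC); computability.
  by apply: (computable_comp iC); computability.
- by computability.
Qed.

Lemma computable_implies_within k beta gamma :
  computable k -> computable beta -> computable gamma ->
  computable (fun x => implies_within (k x) (gamma x) (beta x)).
Proof.
move=> kC bC gC; apply: computable_all => //; apply: computable_has; last first.
  by apply: (computable_comp gC); computability.
have mC : computable (fun x => margin (k x)) by exact: computable_invS.
apply: computable_and; first by computability.
by apply: computable_and; apply: computable_leq_add; computability;
  apply: (computable_comp mC); computability.
Qed.

Lemma computable_refutes k beta gamma :
  computable k -> computable beta -> computable gamma ->
  computable (fun x => refutes (k x) (gamma x) (beta x)).
Proof.
move=> kC bC gC; apply: computable_has => //; apply: computable_has; last first.
  by apply: (computable_comp gC); computability.
have mC : computable (fun x => margin (k x)) by exact: computable_invS.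
apply: computable_and; first by computability.
by apply: computable_or; apply: computable_geq_add; computability;
  apply: (computable_comp mC); computability.
Qed.

Lemma computable_small_cover i d gamma (H : X -> seq (condition * nat)) :
  computable i -> computable d -> computable gamma -> computable H ->
  computable (fun x => small_cover (i x) (d x) (gamma x) (H x)).
Proof.
move=> iC dC gC HC; apply: computable_and.
  have qC : computable (fun p : X * (condition * nat) => p.2.1.2) by computability.
  have [pC nC eC] := computable_num_den qC.
  by computability; first [apply: (computable_comp gC)|apply: (computable_comp dC)];
    computability.
apply: computable_leq; last by computability.
apply: computable_muln; last by computability.
by apply: (computable_foldr (h := fun _ h n => h.2 + n)); computability.
Qed.

End computable.

Lemma trimmed_RE : RE no_oracle (fun p => trimmed p.1 p.2).
Proof.
do 4 apply: RE_ex; apply: RE_dec.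
apply: computable_and.
  by computability; apply: computable_stage; computability.
apply: computable_and; first by apply: computable_implies_within; computability.
apply: computable_and; first by apply: computable_small_cover; computability.
apply: computable_all; last by apply: computable_stage; computability.
by computability; apply: computable_refutes; computability.
Qed.

End trim.

Local Open Scope classical_set_scope.
Local Open Scope ring_scope.

(** * Measures on the Cantor space *)

Lemma measurable_cylinder y : measurable (cylinder y : set Omega).
Proof. by apply: sub_sigma_algebra; exists y. Qed.

Lemma measurable_cylinders (L : set (seq bool)) :
  measurable (\bigcup_(y in L) cylinder y : set Omega).
Proof.
rewrite bigcup_mkcond; apply: countable_bigcupT_measurable => [|y]; first exact: countableP.
by case: ifP => // _; exact: measurable_cylinder.
Qed.

Lemma cylinder_prefix x y : prefix x y -> cylinder y `<=` cylinder x.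
Proof.
move=> /prefixP[z ->] w; rewrite /cylinder /= size_cat.
rewrite /mkseq iotaD map_cat => /eqP; rewrite eqseq_cat; last by rewrite size_map size_iota.
by move=> /andP[/eqP].
Qed.

Lemma cylinder_disjoint x y :
  ~~ prefix x y -> ~~ prefix y x -> cylinder x `&` cylinder y = set0.
Proof.
move=> xy yx; apply/seteqP; split=> // w [] /= ex ey.
have pre (u v : seq bool) :
  (size u <= size v)%N -> mkseq w (size u) = u -> mkseq w (size v) = v -> prefix u v.
  move=> le_uv eu ev; apply/prefixP; exists (map w (iota (size u) (size v - size u))).
  by rewrite -[LHS]ev /mkseq -{1}(subnKC le_uv) iotaD map_cat -/(mkseq w (size u)) eu.
case/orP: (leq_total (size x) (size y)) => le_xy.
  by move: xy; rewrite (pre x y).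
by move: yx; rewrite (pre y x).
Qed.

Definition cylinders (H : seq (seq bool)) : set Omega :=
  [set w | exists2 y, y \in H & cylinder y w].

Lemma cylinders_nil : cylinders [::] = set0.
Proof. by apply/seteqP; split=> w // -[]. Qed.

Lemma cylinders_cons y H : cylinders (y :: H) = cylinder y `|` cylinders H.
Proof.
apply/seteqP; split=> w.
  by move=> [x]; rewrite in_cons => /orP[/eqP -> ?|xH xw]; [left|right; exists x].
by move=> [yw|[x xH xw]]; [exists y|exists x]; rewrite ?mem_head // in_cons xH orbT.
Qed.

Lemma measurable_cylinders_seq H : measurable (cylinders H).
Proof.
elim: H => [|y H IH]; first by rewrite cylinders_nil.
by rewrite cylinders_cons; apply: measurableU => //; exact: measurable_cylinder.
Qed.

Lemma num_denP (v : rat) (a d : nat) :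
  (num_pos v * d <= a * den v + num_neg v * d)%N = (v * d%:R <= a%:R).
Proof.
have e0 : (0 < (den v)%:R :> rat) by rewrite ltr0n den_gt0.
rewrite [in RHS](ratE v) mulrAC ler_pdivrMr // mulrBl lerBlDr.
by rewrite -!natrM -natrD ler_nat.
Qed.

Section measures.
Context {R : realType}.
Implicit Types Q : probability Omega R.

Definition prob Q (y : seq bool) : R := fine (Q (cylinder y)).

Lemma probE Q y : Q (cylinder y) = (prob Q y)%:E.
Proof. by rewrite fineK // fin_num_measure //; exact: measurable_cylinder. Qed.

Lemma prob_ge0 Q y : 0 <= prob Q y.
Proof. exact: fine_ge0. Qed.

Lemma satisfiesE Q (c : condition) :
  satisfies Q c <-> ratr c.1.2 < prob Q c.1.1 < ratr c.2.
Proof. by rewrite /satisfies probE !lte_fin. Qed.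

Definition slice (B : seq bool * seq condition -> Prop) Q : set Omega :=
  [set w | exists z, [/\ B z, forall c, c \in z.2 -> satisfies Q c & cylinder z.1 w]].

Lemma measurable_slice B Q : measurable (slice B Q).
Proof.
rewrite (_ : slice B Q = \bigcup_(y in [set y | exists beta, B (y, beta) /\
    forall c, c \in beta -> satisfies Q c]) cylinder y); first exact: measurable_cylinders.
apply/seteqP; split=> w.
  by move=> [[y beta] [Bz Qz wz]]; exists y => //; exists beta.
by move=> [y [beta [Bz Qz]] wz]; exists (y, beta).
Qed.

Lemma measure_cylinders Q (H : seq (seq bool)) :
  (Q (cylinders H) <= (\sum_(y <- H) prob Q y)%:E)%E.
Proof.
elim: H => [|y H IH].
  by rewrite cylinders_nil measure0 big_nil.
rewrite cylinders_cons big_cons EFinD -probE.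
apply: (@le_trans _ _ (Q (cylinder y) + Q (cylinders H))%E); last exact: leeD2l.
by apply: measureU2; [exact: measurable_cylinder|exact: measurable_cylinders_seq].
Qed.

Lemma measure_disjoint_cylinders Q (H : seq (seq bool)) :
  pairwise (fun x y => ~~ prefix x y && ~~ prefix y x) H ->
  (Q (cylinders H) = (\sum_(y <- H) prob Q y)%:E)%E.
Proof.
elim: H => [_|y H IH /= /andP[yH H_]].
  by rewrite cylinders_nil measure0 big_nil.
rewrite cylinders_cons big_cons EFinD -probE -IH //.
apply: measureU; [exact: measurable_cylinder|exact: measurable_cylinders_seq|].
apply/seteqP; split=> // w [yw [x xH xw]].
by have /andP[? ?] := allP yH x xH; rewrite -(cylinder_disjoint (x := y) (y := x)).
Qed.

(** Discarding the words that extend others leaves disjoint intervals with the same union, whose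
    measures therefore add up to the measure of that union. *)
Lemma minimal_words (F : seq (seq bool)) : exists G : seq (seq bool),
  [/\ {subset G <= F}, pairwise (fun x y => ~~ prefix x y && ~~ prefix y x) G &
      forall x : seq bool, x \in F -> has (fun y => prefix y x) G].
Proof.
elim: F => [|x F [G [GF Gp FG]]]; first by exists [::].
have [Gx|nGx] := boolP (has (fun y => prefix y x) G).
  exists G; split=> // y; first by move=> /GF yF; rewrite in_cons yF orbT.
  by rewrite in_cons => /orP[/eqP->|/FG].
exists (x :: [seq y <- G | ~~ prefix x y]); split.
- move=> y; rewrite !in_cons => /orP[->//|]; rewrite mem_filter => /andP[_ /GF ->].
  by rewrite orbT.
- rewrite /= pairwise_filter // andbT; apply/allP => y; rewrite mem_filter => /andP[-> yG].
  by apply: contra nGx => yx; apply/hasP; exists y.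
- move=> y; rewrite in_cons => /orP[/eqP->|/FG/hasP[z zG zy]] /=;
  first by rewrite prefix_refl.
  have [xz|nxz] := boolP (prefix x z); first by rewrite (prefix_trans xz zy).
  by apply/orP; right; apply/hasP; exists z => //; rewrite mem_filter nxz.
Qed.

(** * Trimmed sets have small measure *)

Section trim.
Variable T : nat * (seq bool * seq condition) -> nat -> bool.

Definition within k Q (beta : seq condition) : Prop := forall c, c \in beta ->
  ratr c.1.2 + ratr (margin k) <= prob Q c.1.1 /\ prob Q c.1.1 + ratr
    (margin k) <= ratr c.2.

Definition stage_set i k Q : set Omega :=
  [set w | exists z, [/\ z \in stage T i k, within k Q z.2 & cylinder z.1 w]].

Lemma margin_le k k' : (k <= k')%N -> margin k' <= margin k.
Proof. by move=> le_k; rewrite /margin lef_pV2 ?posrE ?ltr0n// ler_nat. Qed.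

Lemma stage_set_le i k k' Q : (k <= k')%N -> stage_set i k Q `<=` stage_set i k' Q.
Proof.
move=> le_k w [z [zk wz wzw]]; exists z; split=> //; first exact: stage_le zk.
have le_m : ratr (margin k') <= ratr (margin k) :> R by rewrite ler_rat margin_le.
move=> c /wz[h1 h2]; split; [apply: le_trans h1|apply: le_trans h2]; by rewrite lerD2l.
Qed.

Lemma measurable_stage_set i k Q : measurable (stage_set i k Q).
Proof.
rewrite (_ : stage_set i k Q =
  \bigcup_(y in [set y | exists beta, (y, beta) \in stage T i k /\
    within k Q beta]) cylinder y); first exact: measurable_cylinders.
apply/seteqP; split=> w.
  by move=> [[y beta] [Bz Qz wz]]; exists y => //; exists beta.
by move=> [y [beta [Bz Qz]] wz]; exists (y, beta).
Qed.

Lemma implies_withinP k Q gamma beta : (forall c, c \in gamma -> satisfies Q c) ->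
  implies_within k gamma beta -> within k Q beta.
Proof.
move=> Qg /allP ib c /ib/hasP[g /Qg/satisfiesE/andP[gl gr] /and3P[/eqP <- l r]].
rewrite -!(ler_rat R) !rmorphD /= in l r; split; first exact: le_trans l (ltW gl).
by apply: le_trans r; rewrite lerD2r ltW.
Qed.

Lemma refutesP k Q gamma beta : (forall c, c \in gamma -> satisfies Q c) ->
  refutes k gamma beta -> ~ within k Q beta.
Proof.
move=> Qg /hasP[c cb /hasP[g /Qg/satisfiesE/andP[gl gr] /andP[/eqP e h]]] /(_ _ cb)[l r].
rewrite -!(ler_rat R) !rmorphD /= in h; rewrite e in gl gr.
case/orP: h => h.
  by have := lt_le_trans gr (le_trans h l); rewrite ltxx.
by have := le_trans r h; rewrite lerD2r leNgt gl.
Qed.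

Lemma small_coverP i d Q gamma H : (forall c, c \in gamma -> satisfies Q c) ->
  small_cover i d gamma H -> \sum_(h <- H) prob Q h.1.1.1 <= 4^-1 ^+ i.
Proof.
move=> Qg /andP[/allP Hg].
have d0 : (0 < d.+1%:R :> R) by rewrite ltr0n.
rewrite -(ler_nat R) natrM natrX exprVn => sumH.
have {sumH} : (foldr (fun h n => h.2 + n)%N 0%N H)%:R / d.+1%:R <= (4 ^+ i)^-1 :> R.
  by rewrite ler_pdivrMr // mulrC ler_pdivlMr // exprn_gt0 // ltr0n.
apply: le_trans.
elim: H Hg => [|h H IH] Hg; first by rewrite big_nil mul0r.
rewrite big_cons /= natrD mulrDl lerD //; last first.
  by apply: IH => h' h'H; apply: Hg; rewrite in_cons h'H orbT.
have /andP[/Qg/satisfiesE/andP[_ /ltW qv] le_h] := Hg h (mem_head _ _).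
move: le_h; rewrite num_denP -(ler_rat R) rmorphM /= !ratr_nat => le_h.
by apply: le_trans qv _; rewrite ler_pdivlMr.
Qed.

Lemma measure_bigcup_le Q (F : nat -> set Omega) (c : \bar R) :
  (forall k, measurable (F k)) -> (forall n, Q (\big[setU/set0]_(k < n) F k) <= c)%E ->
  (Q (\bigcup_k F k) <= c)%E.
Proof.
move=> mF le_c; rewrite -bigcup_bigsetU_bigcup.
have mG n : measurable (\big[setU/set0]_(k < n.+1) F k) by exact: bigsetU_measurable.
have homoG : {homo (fun n => \big[setU/set0]_(k < n.+1) F k) :
  m n / (m <= n)%N >-> (m <= n)%O}.
  by move=> m n le_mn; apply/subsetPset; apply: subset_bigsetU.
have cvgG := nondecreasing_cvg_mu (mu := Q) mG (bigcupT_measurable _ mG) homoG.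
rewrite -(cvg_lim _ cvgG) //; apply: lime_le; first by apply/cvg_ex; eexists; exact: cvgG.
by apply: nearW => n; exact: le_c.
Qed.

(** A certificate bounds the whole stage set containing its interval, not just the interval. Stage
    sets increase, so finitely many certified ones lie in the last of them; continuity from below
    then gives the same bound for the full union. *)
Lemma trimmed_le i Q : (Q (slice (trimmed T i) Q) <= (4^-1 ^+ i)%:E)%E.
Proof.
set c := (_%:E)%E.
pose F k := if (Q (stage_set i k Q) <= c)%E then stage_set i k Q else set0.
have mF k : measurable (F k).
  by rewrite /F; case: ifP => // _; exact: measurable_stage_set.
have sub : slice (trimmed T i) Q `<=` \bigcup_k F k.
  move=> w [z [[k [beta [H [d /and4P[zk zb small /allP cov]]]]] Qz zw]].
  exists k => //; rewrite /F.
  (* An interval whose conditions [gamma] refutes contributes nothing at [Q]; every other interval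
     of the stage lies under [H]. *)
  have stageH : stage_set i k Q `<=` cylinders [seq h.1.1.1 | h <- H].
    move=> v [z' [z'k z'w z'v]]; have /orP[/hasP[h hH hz']|] := cov z' z'k.
      by exists h.1.1.1; [exact: map_f|exact: cylinder_prefix hz' _ _].
    by move=> /(refutesP Qz)/(_ z'w).
  rewrite ifT; first by exists (z.1, beta); split=> //; exact: implies_withinP zb.
  apply: le_trans (le_measure _ _ _ stageH) _; rewrite ?inE //;
    first exact: measurable_stage_set.
    exact: measurable_cylinders_seq.
  apply: le_trans (measure_cylinders _ _) _.
  by rewrite big_map lee_fin (small_coverP Qz small).
apply: le_trans (le_measure _ _ _ sub) _; rewrite ?inE; first exact: measurable_slice.
  exact: bigcupT_measurable.
apply: measure_bigcup_le => // n.
have [->|[m [subm le_m]]] : \big[setU/set0]_(k < n) F k = set0 \/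
    exists m, [/\ \big[setU/set0]_(k < n) F k `<=` stage_set i m Q,
      (m <= n)%N & (Q (stage_set i m Q) <= c)%E].
- elim: n => [|n IH]; first by left; rewrite big_ord0.
  rewrite big_ord_recr /= {2 4}/F; case: ifP => [le_n|_].
    right; exists n; split=> //; case: IH => [->|[m [subm le_mn _]]];
      first by rewrite set0U.
    rewrite subUset; split=> //; apply: subset_trans subm _; exact: stage_set_le.
  rewrite setU0; case: IH => [->|[m [? le_mn ?]]]; [by left|right].
  by exists m; split=> //; exact: leqW.
- by rewrite measure0 lee_fin exprn_ge0.
- move=> le_c; apply: le_trans le_c; apply: le_measure; rewrite ?inE //.
    exact: bigsetU_measurable.
  exact: measurable_stage_set.
Qed.

End trim.
End measures.

(** * Trimming preserves slices of small measure *)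

Section completeness.
Context {R : realType}.
Variable T : nat * (seq bool * seq condition) -> nat -> bool.
Implicit Types Q : probability Omega R.

Lemma prob_le1 Q y : prob Q y <= 1.
Proof. by rewrite -lee_fin -probE; apply: probability_le1; exact: measurable_cylinder. Qed.

Lemma satisfies_margin Q (beta : seq condition) : (forall c, c \in beta -> satisfies Q c) ->
  exists k, forall c, c \in beta ->
    ratr c.1.2 + ratr (margin k) < prob Q c.1.1 /\ prob Q c.1.1 + ratr
      (margin k) < ratr c.2 :> R.
Proof.
elim: beta => [|c beta IH] Qb; first by exists 0%N.
have [|k kP] := IH; first by move=> c' c'b; apply: Qb; rewrite in_cons c'b orbT.
have /satisfiesE/andP[/ltr_add_invr[m mP] /ltr_add_invr[n nP]] := Qb c (mem_head _ _).
have ratr_margin j : ratr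
  (margin j) = j.+1%:R^-1 :> R by rewrite /margin fmorphV /= ratr_nat.
have le_l j : (j <= maxn k (maxn m n))%N -> ratr (margin (maxn k (maxn m n))) <= ratr
  (margin j) :> R.
  by move=> le_j; rewrite ler_rat margin_le.
exists (maxn k (maxn m n)) => c'; rewrite in_cons => /orP[/eqP->|/kP[l r]]; split.
- by apply: le_lt_trans mP; rewrite lerD2l -ratr_margin le_l // !leq_max leqnn orbT.
- by apply: le_lt_trans nP; rewrite lerD2l -ratr_margin le_l // !leq_max leqnn !orbT.
- by apply: le_lt_trans l; rewrite lerD2l le_l // leq_maxl.
- by apply: le_lt_trans r; rewrite lerD2l le_l // leq_maxl.
Qed.

(** The certificate [gamma] is assembled from strict conditions true of [Q]: upper bounds for a
    disjoint cover of the stage set, the shrunk conditions of [beta], and witnesses that the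
    remaining intervals of the stage fail. The strict hypothesis leaves room for rounding the upper
    bounds. *)
Lemma trimmed_complete i Q :
  (Q (slice (fun z => exists s, T (i, z) s) Q) < (4^-1 ^+ i)%:E)%E ->
  slice (fun z => exists s, T (i, z) s) Q `<=` slice (trimmed T i) Q.
Proof.
move=> small w [[x beta] [/stage_ex[k0 zk0] Qb wx]].
have [k1 k1P] := satisfies_margin Qb.
pose k := maxn k0 k1.
have zk : (x, beta) \in stage T i k by apply: stage_le zk0; exact: leq_maxl.
have le_m : ratr (margin k) <= ratr
  (margin k1) :> R by rewrite ler_rat margin_le // leq_maxr.
have mk0 : 0 < margin k by rewrite invr_gt0 ltr0n.
have rmk0 : 0 < ratr (margin k) :> R by rewrite ltr0q.
pose F := [seq z.1 | z <- stage T i k & `[< within k Q z.2 >]].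
have [G [GF Gp FG]] := minimal_words F.
have sumG : \sum_(y <- G) prob Q y < 4^-1 ^+ i.
  rewrite -lte_fin -measure_disjoint_cylinders //; apply: le_lt_trans small.
  apply: le_measure; rewrite ?inE;
    [exact: measurable_cylinders_seq|exact: measurable_slice|].
  move=> v [y /GF/mapP[z]]; rewrite mem_filter => /andP[/asboolP zw z_k ->] yv.
  exists z; split=> //; first by apply/stage_ex; exists k.
  move=> c /zw[l r]; apply/satisfiesE/andP; split.
    by apply: lt_le_trans l; rewrite ltrDl.
  by apply: lt_le_trans r; rewrite ltrDl.
(* Rounding up to a multiple of [1 / (d + 1)] costs at most that much per word of [G]; [d] is chosen
   so that the total cost fits in the gap below [4 ^ -i]. *)
have [d dP] : exists d : nat, (size G)%:R <= d.+1%:R * (4^-1 ^+ i - \sum_(y <- G) prob Q y).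
  exists (Num.truncn ((size G)%:R / (4^-1 ^+ i - \sum_(y <- G) prob Q y))).
  by rewrite -ler_pdivrMr ?subr_gt0 // ltW // truncnS_gt.
(* The successor of the truncation makes the upper bound strict, as a condition in [gamma] must
   be. *)
pose a y := (Num.truncn (prob Q y * d.+1%:R)).+1.
have d0 : 0 < d.+1%:R :> R by rewrite ltr0n.
have aP y : prob Q y * d.+1%:R < (a y)%:R <= prob Q y * d.+1%:R + 1.
  rewrite truncnS_gt /= /a -[(Num.truncn _).+1%:R]natr1 lerD2r truncn_le //.
  by rewrite mulr_ge0 // prob_ge0.
pose v y : rat := (a y)%:R / d.+1%:R.
(* The lower bound -1 imposes nothing on a probability. *)
pose H : seq (condition * nat) := [seq ((y, -1, v y), a y) | y <- G].
pose inner : seq condition := [seq (c.1.1, c.1.2 + margin k, c.2 - margin k) | c <- beta].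
(* A one-sided strict condition for each way in which [Q] fails the closed condition [c] with its
   margin; -1 and 2 are bounds that every probability meets. *)
pose outer (c : condition) : seq condition :=
  (if prob Q c.1.1 < ratr c.1.2 + ratr
    (margin k) then [:: (c.1.1, -1, c.1.2 + margin k)] else [::]) ++
  (if ratr c.2 < prob Q c.1.1 + ratr
    (margin k) then [:: (c.1.1, c.2 - margin k, 2)] else [::]).
pose gamma := map fst H ++ inner ++ flatten
  [seq flatten [seq outer c | c <- z.2] | z <- stage T i k].
have ratrN1 y : ratr (-1) < prob Q y by rewrite rmorphN1 (lt_le_trans _ (prob_ge0 Q y)).
have Qg c : c \in gamma -> satisfies Q c.
  rewrite !mem_cat => /or3P[].
  - rewrite -map_comp => /mapP[y _ ->]; apply/satisfiesE; rewrite /= ratrN1 /=.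
    by rewrite fmorph_div /= !ratr_nat ltr_pdivlMr //; case/andP: (aP y).
  - move=> /mapP[c' /k1P[l r] ->]; apply/satisfiesE; rewrite /= rmorphD rmorphB /=.
    rewrite (le_lt_trans _ l) ?lerD2l //= ltrBrDr (le_lt_trans _ r) //.
    by rewrite lerD2l.
  - move=> /flatten_mapP[z _ /flatten_mapP[c' _]]; rewrite mem_cat => /orP[].
      case: ifP => // h; rewrite inE => /eqP->; apply/satisfiesE; rewrite /= ratrN1 /=.
      by rewrite rmorphD.
    case: ifP => // h; rewrite inE => /eqP->; apply/satisfiesE; rewrite /= rmorphB /=.
    rewrite ltrBlDr h /= (le_lt_trans (prob_le1 _ _)) //.
    by rewrite ratr_nat ltr1n.
exists (x, gamma); split=> //.
exists k, beta, H, d; apply/and4P; split=> //=.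
- apply/allP => c cb; apply/hasP; exists (c.1.1, c.1.2 + margin k, c.2 - margin k).
    by rewrite !mem_cat (map_f _ cb) orbT.
  by rewrite /= eqxx lexx subrK lexx.
- apply/andP; split.
    apply/allP => h hH; rewrite num_denP mem_cat (map_f fst hH) /=.
    by move: hH => /mapP[y _ ->] /=; rewrite divfK // pnatr_eq0.
  rewrite -(ler_nat R) natrM natrX.
  have -> : (foldr (fun h n => h.2 + n)%N 0%N H) = (\sum_(y <- G) a y)%N.
    rewrite /H; elim: (G) => [|y l IH]; first by rewrite big_nil.
    by rewrite big_cons /= IH.
  rewrite natr_sum; have : \sum_(y <- G) (a y)%:R <=
    (\sum_(y <- G) prob Q y) * d.+1%:R + (size G)%:R :> R.
    elim: (G) => [|y l IH]; first by rewrite !big_nil mul0r addr0.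
    rewrite !big_cons /= -[(size l).+1%:R]natr1 mulrDl; have /andP[_ ay] := aP y.
    by apply: le_trans (lerD ay IH) _; rewrite addrACA [1 + _]addrC.
  have p4 : 0 < 4 ^+ i :> R by rewrite exprn_gt0 // ltr0n.
  rewrite -ler_pdivlMr // => /le_trans; apply.
  by move: dP; rewrite exprVn mulrBr [_ * \sum_(_ <- _) _]mulrC lerBrDl.
- apply/allP => z zS; apply/orP.
  have [zw|nzw] := pselect (within k Q z.2); [left|right].
    have zF : z.1 \in F by apply: map_f; rewrite mem_filter zS andbT; exact/asboolP.
    have /hasP[y yG yz] := FG _ zF.
    by apply/hasP; exists ((y, -1, v y), a y) => //; exact: map_f.
  move: nzw => /existsNP[c /not_implyP[cz /not_andP nc]].
  have og g : g \in outer c -> g \in gamma.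
    move=> gc; rewrite !mem_cat; apply/or3P/Or33.
    by apply/flatten_mapP; exists z => //; apply/flatten_mapP; exists c.
  apply/hasP; exists c => //; apply/hasP.
  case: nc => /negP; rewrite -ltNge => h.
    exists (c.1.1, -1, c.1.2 + margin k); last by rewrite /= eqxx lexx.
    by apply: og; rewrite /outer h mem_head.
  exists (c.1.1, c.2 - margin k, 2); last by rewrite /= eqxx subrK lexx orbT.
  by apply: og; rewrite /outer h mem_cat mem_head orbT.
Qed.

End completeness.

Lemma computable_code o X Y {cX : coded X} {cY : coded Y} (f : X -> Y) :
  computable o f -> computable o (fun x => code (f x)).
Proof. by apply: computable_recode. Qed.

(** * Martin-Löf randomness implies uniform randomness *)

Section tests.
Context {R : realType}.
Implicit Types (P Q : probability Omega R) (t : Omega -> probability Omega R -> \bar R).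

(** Sections of superlevel sets at rational levels are unions of intervals, and the superlevel set
    at a real [x] is the union of those at the rationals above [x]. *)
Lemma measurable_lower_semicomputable t Q :
  lower_semicomputable t -> measurable_fun setT (t ^~ Q).
Proof.
move=> [p tP] mD; apply: (measurability _ (ErealGenOInfty.measurableE R)) => //.
move=> /= _ [_ [x ->]] <-; rewrite setTI.
rewrite (_ : _ @^-1` _ = \bigcup_(r : rat)
    if x < ratr r then [set w | ((ratr r)%:E < t w Q)%E] else set0).
  apply: bigcupT_measurable_rat => r; case: ifP => // _.
  have -> : [set w | ((ratr r)%:E < t w Q)%E] =
      slice (enumerated code_basic no_oracle p (code_rat r)) Q.
    apply/seteqP; split=> w.
      move=> wr; have : [set wP | ((ratr r)%:E < t wP.1 wP.2)%E] (w, Q) by [].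
      by rewrite tP => -[z zr [zw Qz]]; exists z.
    move=> [z [zr Qz zw]].
    suff : [set wP | ((ratr r)%:E < t wP.1 wP.2)%E] (w, Q) by [].
    by rewrite tP; exists z.
  exact: measurable_slice.
apply/seteqP; split=> w; rewrite /= in_itv /= andbT.
  case E : (t w Q) => [s| |] //.
    rewrite lte_fin => /rat_in_itvoo[q]; rewrite in_itv /= => /andP[xq qs].
    by exists q => //; rewrite xq /= E lte_fin.
  have /rat_in_itvoo[q] : x < x + 1 by rewrite ltrDl.
  by rewrite in_itv /= => /andP[xq _] _; exists q => //; rewrite xq /= E ltry.
by move=> [q _]; case: ifP => // xq /=; apply: lt_trans; rewrite lte_fin.
Qed.

Lemma markov_pow2 t P i : uniform_test t ->
  (P [set w | ((2 ^+ i)%:E < t w P)%E] <= (2^-1 ^+ i)%:E)%E.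
Proof.
move=> [t0 tC t1]; have mt := measurable_lower_semicomputable P tC.
have p2 : 0 < 2 ^+ i :> R by rewrite exprn_gt0.
have := le_integral_abse P measurableT mt p2.
rewrite (eq_integral (t ^~ P)); last by move=> w _; rewrite gee0_abs.
move=> /le_trans/(_ (t1 P)) h.
have mgt := emeasurable_fun_o_infty measurableT mt (2 ^+ i)%:E.
have mge := emeasurable_fun_c_infty measurableT mt (2 ^+ i)%:E.
rewrite setTI in mgt; rewrite setTI in mge.
rewrite exprVn -(@lee_pmul2l _ (2 ^+ i)%:E) // -EFinM divff ?gt_eqF //.
apply: le_trans h; rewrite lee_pmul2l // setTI; apply: le_measure; rewrite ?inE //.
  rewrite (_ : [set _ | _] = [set w | (2 ^+ i)%:E <= t w P]%E) //.
  by apply/seteqP; split=> w; rewrite /= gee0_abs.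
by move=> w /= /ltW; rewrite gee0_abs.
Qed.

(** A single answer [er.2] of precision [er.1] verifies the condition when it is further than this
    precision inside the interval. *)
Definition satisfies_by (F : nat -> nat -> Prop) (c : condition) : Prop :=
  exists er : rat * rat, F (pairing (code c.1.1) (code er.1)) (code er.2) /\
    [&& 0 < er.1, c.1.2 + er.1 < er.2 & er.2 + er.1 < c.2].

(** [approximates] only provides some correct answer related to the query; single-valuedness
    identifies it with the answer found. *)
Lemma satisfies_byP P F c :
  approximates P F -> (forall n m m', F n m -> F n m' -> m = m') ->
  satisfies P c <-> satisfies_by F c.
Proof.
move=> approx F_fun; split.
  move=> Pc; have [|k kP] := @satisfies_margin _ P [:: c].
    by move=> c'; rewrite inE => /eqP->.
  have [l r] := kP c (mem_head _ _).
  (* Half of the margin covers the error of the answer, and half remains as the distance that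
     [satisfies_by] demands. *)
  have e0 : 0 < margin k / 2 by rewrite divr_gt0 // invr_gt0 ltr0n.
  have [q Fq] := approx c.1.1 _ e0.
  rewrite probE -EFinB lee_fin ler_distl => /andP[ql qr].
  exists (margin k / 2, q); split=> //=; rewrite e0 /= -!(ltr_rat R) !rmorphD /=.
  move: l r ql qr; rewrite [margin k]splitr rmorphD /= => l r ql qr.
  by apply/andP; split; lra.
move=> [[e q] /= [Fq /and3P[e0 l r]]].
have [q' Fq'] := approx c.1.1 e e0.
have /code_rat_inj <- : code_rat q = code_rat q' by exact: F_fun Fq Fq'.
rewrite probE -EFinB lee_fin ler_distl => /andP[ql qr]; apply/satisfiesE.
by move: l r; rewrite -!(ltr_rat R) !rmorphD /= => l r; apply/andP; split; lra.
Qed.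

Lemma RE_sem0 o (rho : nat -> nat -> Prop) p :
  RE o (fun x : nat * nat => rho x.1 x.2) -> RE o (fun x : nat * nat => sem rho p x.1 x.2).
Proof.
move=> rhoR.
have rhoR' : RE o (fun x : bool * (nat * nat) => rho x.2.1 x.2.2).
  by apply: (RE_comp (S := fun x => rho x.1 x.2) rhoR); computability.
exact: (RE_comp3 (S := fun _ => _) (f := fun _ => true)
  (RE_sem (rho := fun _ => rho) p rhoR')
  (computable_cst _ _) (computable_fst (computable_id _))
    (computable_snd (computable_id _))).
Qed.

(** The test is enumerated without oracle, but this enumeration is searched by a program with oracle
    [A]; the zero oracle is replaced by its decidable graph. *)
Lemma RE_eval_no_oracle o p : RE o (fun x : nat * nat => eval no_oracle p x.1 x.2).
Proof.
apply: (@eq_RE _ _ _ (fun x => sem (graph no_oracle) p x.1 x.2)) => [x|].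
  by rewrite evalP.
by apply: RE_sem0; apply: RE_eq; computability.
Qed.

Lemma RE_satisfies_by o p : RE o (satisfies_by (eval o p)).
Proof.
apply: RE_ex; apply: RE_and.
  apply: (RE_comp (S := fun x => eval o p x.1 x.2)
    (f := fun x : condition * (rat * rat) =>
      (pairing (code x.1.1.1) (code x.2.1), code x.2.2)) (RE_eval o p)).
  by computability; apply: computable_code; computability.
apply: RE_dec; apply: computable_and; first by apply: computable_ltq; computability.
by apply: computable_and; apply: computable_add_lt; computability.
Qed.

Theorem random_of_martin_lof_random t P (A : nat -> bool) w :
  uniform_test t -> computable_relative_to P A -> martin_lof_random P A w ->
  uniformly_random t P w.
Proof.
move=> t_test [q qP] w_random; case: (t_test) => t0 [p tP] _.
rewrite /uniformly_random ltey; apply/eqP => tw.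
pose U i : set Omega := [set v | ((2 ^+ i)%:E < t v P)%E].
apply: (w_random U); last by move=> i _; rewrite /U /= tw ltry.
split; last by move=> i; exact: markov_pow2.
pose oA := set_oracle A.
(* Satisfied conditions are replaced by verified ones: [beta] is finite, and each of its conditions
   is confirmed by a run of [q] with oracle [A]. *)
pose S (i : nat) (y : seq bool) := exists beta : seq condition,
  (exists k, eval no_oracle p (pairing (code_rat (2 ^ i)%N%:R) k) (code_basic (y, beta))) /\
  forall c, c \in beta -> satisfies_by (eval oA q) c.
have SR : RE oA (fun x => S x.1 x.2).
  apply: RE_ex; apply: RE_and.
    apply: RE_ex.
    apply: (RE_comp (S := fun x => eval no_oracle p x.1 x.2)
      (f := fun x : nat * seq bool * seq condition * nat =>
        (pairing (code ((2 ^ x.1.1.1)%N%:R : rat)) x.2, code (x.1.1.2, x.1.2)))).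
      exact: RE_eval_no_oracle.
    computability; apply: computable_code; computability.
    by apply: computable_natq; computability.
  apply: RE_all; last by computability.
  by apply: (RE_comp (S := satisfies_by (eval oA q)) (f := snd));
    [exact: RE_satisfies_by|computability].
have [p' p'P] := RE_enumerated SR.
exists p' => i.
have -> : enumerated code_word oA p' i = [set y | S i y] := p'P i.
have -> : U i = \bigcup_(b in enumerated code_basic no_oracle p (code_rat (2 ^ i)%N%:R))
   [set v | basic_open b (v, P)].
  have e : ratr ((2 ^ i)%N%:R : rat) = 2 ^+ i :> R by rewrite ratr_nat natrX.
  apply/seteqP; split=> v; rewrite /U /= -e.
    move=> tv; suff : [set vP | ((ratr ((2 ^ i)%N%:R : rat))%:E < t vP.1 vP.2)%E] (v, P).
      by rewrite tP => -[b bp vb]; exists b.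
    by [].
  move=> [b bp vb]; suff : [set vP | ((ratr ((2 ^ i)%N%:R : rat))%:E < t vP.1 vP.2)%E]
    (v, P) by [].
  by rewrite tP; exists b.
have sat c := satisfies_byP c qP (@eval_fun oA q).
apply/seteqP; split=> v.
  move=> [[y beta] bp [/= yv bv]]; exists y => //; exists beta; split=> //.
  by move=> c /bv/sat.
by move=> [y [beta [bp bv]] yv]; exists (y, beta) => //; split=> // c /bv/sat.
Qed.

End tests.

(** * Uniform randomness implies Martin-Löf randomness *)

Section trimmed_test.
Context {R : realType}.
Variable T : nat * (seq bool * seq condition) -> nat -> bool.
Hypothesis TC : computable no_oracle (fun p => T p.1 p.2).
Implicit Types Q : probability Omega R.

Definition trimmed_test (w : Omega) Q : \bar R :=
  ereal_sup [set i%:R%:E | i in [set i : nat | i = 0%N \/ slice (trimmed T i) Q w]].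

Lemma trimmed_test_ge0 w Q : (0 <= trimmed_test w Q)%E.
Proof. by apply: ereal_sup_ubound; exists 0%N => //; left. Qed.

Lemma trimmed_test_lower_semicomputable : lower_semicomputable trimmed_test.
Proof.
(* At negative levels the superlevel set is the whole space, that is, the basic set of the empty
   word without conditions. *)
pose S (r : rat) (z : seq bool * seq condition) :=
  (r < 0 /\ z = ([::], [::])) \/ exists i : nat, r < i%:R /\ trimmed T i z.
have SR : RE no_oracle (fun x => S x.1 x.2).
  apply: RE_or.
    apply: RE_and; first by apply: RE_dec; apply: computable_ltq; computability.
    by apply: RE_eq; computability.
  apply: RE_ex; apply: RE_and.
    apply: RE_dec; apply: computable_ltq; first by computability.
    by apply: computable_natq; computability.
  apply: (RE_comp (S := fun p => trimmed T p.1 p.2)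
    (f := fun x : rat * (seq bool * seq condition) * nat => (x.2, x.1.2))).
    exact: trimmed_RE.
  by computability.
have [p pP] := RE_enumerated SR; exists p => r.
have -> : enumerated code_basic no_oracle p (code_rat r) = [set z | S r z] := pP r.
apply/seteqP; split=> -[w Q] /=.
  move=> /ereal_sup_gt[_ [i /= iw <-]]; rewrite lte_fin => ri.
  have {}ri : r < i%:R by rewrite -(ltr_rat R) ratr_nat.
  case: iw => [i0|[z [iz Qz zw]]]; last by exists z => //; right; exists i.
  by exists ([::], [::]) => //; left; split=> //; move: ri; rewrite i0.
move=> [z [[r0 ->] _|[i [ri iz]] [zw Qz]]].
  by apply: lt_le_trans (trimmed_test_ge0 w Q); rewrite lte_fin ltrq0.
apply/ereal_sup_gtP; exists i%:R%:E; last by rewrite lte_fin -(ratr_nat R) ltr_rat.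
by exists i => //; right; exists z.
Qed.

Lemma measurable_trimmed_test Q : measurable_fun setT (trimmed_test ^~ Q).
Proof.
apply: measurable_lower_semicomputable; exact: trimmed_test_lower_semicomputable.
Qed.

(** The supremum is at most the sum of the indicators of the trimmed sets weighted by [i], and
    [i * 4 ^ -i <= 2 ^ -(i + 1)]. *)
Lemma trimmed_test_integral Q : (\int[Q]_w trimmed_test w Q <= 1)%E.
Proof.
pose f i w := (i%:R%:E * (\1_(slice (trimmed T i) Q) w : R)%:E)%E.
have f0 i w : (0 <= f i w)%E by rewrite /f mule_ge0 // lee_fin.
have mI i : measurable_fun setT (fun w : Omega => (\1_(slice (trimmed T i) Q) w : R)%:E).
  by apply/measurable_EFinP; apply: measurable_indic; exact: measurable_slice.
have mf i : measurable_fun setT (f i) by apply: measurable_funeM; exact: mI.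
have le_f w : (trimmed_test w Q <= \sum_(0 <= i <oo) f i w)%E.
  apply: ge_ereal_sup => _ [i [->|iw] <-]; first by apply: nneseries_ge0.
  apply: le_trans (nneseries_lim_ge i.+1 _) => //.
  rewrite big_nat_recr //= -[leLHS]add0e leeD //; first exact: sume_ge0.
  by rewrite /f indicE mem_set // mule1.
apply: le_trans (ge0_le_integral _ measurableT _ _ _ (fun w _ => le_f w)) _ => //.
- by move=> w _; exact: trimmed_test_ge0.
- exact: measurable_trimmed_test.
- exact: ge0_emeasurable_sum.
rewrite integral_nneseries //.
(* With zero terms, this bounds the sum of [2 ^ -(i + 1)] by 1. *)
have := @epsilon_trick R (fun=> 0%E) 1 xpredT (fun=> lexx _) ler01.
rewrite [X in (_ <= X + _)%E -> _]eseries0 // add0e; apply: le_trans;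
  apply: lee_nneseries => [i _ _|i _].
  exact: integral_ge0.
rewrite ge0_integralZl // integral_indic //; last exact: measurable_slice.
rewrite setIT add0e.
apply: (@le_trans _ _ (i%:R%:E * (4^-1 ^+ i)%:E)%E); first by apply: lee_pmul => //;
  exact: trimmed_le.
rewrite -EFinM lee_fin div1r exprVn ler_pdivrMr ?exprn_gt0 //.
rewrite mulrC ler_pdivlMr; last by rewrite ltr0n expn_gt0.
rewrite -natrX -natrM ler_nat (_ : 4 = 2 * 2)%N // expnMn expnS mulnA leq_mul2r.
(* After cancellation of [2 ^ i], there remains [i * 2 <= 2 ^ i]. *)
by apply/orP; right; elim: (i) => // -[|j] IH //; rewrite expnS mulSn; lia.
Qed.

Lemma trimmed_testP : uniform_test trimmed_test.
Proof.
split; [exact: trimmed_test_ge0|exact: trimmed_test_lower_semicomputable|].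
exact: trimmed_test_integral.
Qed.

Lemma trimmed_test_pinfty w Q :
  (forall i, slice (trimmed T i) Q w) -> trimmed_test w Q = +oo%E.
Proof.
move=> iw; apply/eqyP => r _; apply: (@le_trans _ _ (Num.truncn r).+1%:R%:E).
  by rewrite lee_fin ltW // truncnS_gt.
by apply: ereal_sup_ubound; exists (Num.truncn r).+1 => //; right.
Qed.

End trimmed_test.

Lemma code_query (y : seq bool) (e : rat) :
  pairing (code_word y) (code_rat e) = code (y, e).
Proof. by []. Qed.

(** * Replacing the oracle [A] by approximations to the measure *)

Section relativization.
Context {R : realType}.
Variables (P : probability Omega R) (A : nat -> bool) (p q : program).
Hypothesis qP : forall o : nat -> nat,
  approximates P (fun n m => o n = m) -> forall n, eval o q n (A n).
Implicit Types (i : nat) (s : seq nat) (beta : seq condition).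

(** Queries beyond the end of [s] get no answer, not a default one, so outputs persist under every
    extension of [s]. *)
Definition segment s (n m : nat) : Prop := (n < size s)%N /\ nth 0%N s n = m.

(* The conditions in beta guarantee that s is the beginning of an oracle giving
   approximations to P. *)
Definition guarantees beta s : bool :=
  all (fun n => if decode n : option (seq bool * rat) is Some ye then
      (0 < ye.2) ==> (if decode (nth 0%N s n) : option rat is Some r then
        has (fun c => [&& c.1.1 == ye.1, r <= c.1.2 + ye.2 & c.2 <= r + ye.2]) beta
      else false)
    else true) (below (size s)).

(* With the beginning s of an oracle, q computes a finite part of A (or of some
   other relation, for measures other than P), which serves as oracle to p. *)
Definition relativized i (z : seq bool * seq condition) : Prop :=
  exists s, guarantees z.2 s /\
    exists k, sem (sem (segment s) q) p (pairing i k) (code_word z.1).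

Lemma guarantees_computable o :
  computable o (fun x : seq condition * seq nat => guarantees x.1 x.2).
Proof.
apply: computable_all; last by computability.
apply: (computable_opt (f := fun (x : seq condition * seq nat * nat)
  (ye : seq bool * rat) =>
  (0 < ye.2) ==> (if decode (nth 0%N x.1.2 x.2) : option rat is Some r then
        has (fun c : condition =>
          [&& c.1.1 == ye.1, r <= c.1.2 + ye.2 & c.2 <= r + ye.2]) x.1.1
      else false))).
- by apply: computable_decode; computability.
- apply: computable_implb; first by apply: computable_ltq; computability.
  apply: (computable_opt (f := fun
    (x : seq condition * seq nat * nat * (seq bool * rat)) (r : rat) =>
        has (fun c : condition =>
          [&& c.1.1 == x.2.1, r <= c.1.2 + x.2.2 & c.2 <= r + x.2.2]) x.1.1.1)).
  + by apply: computable_decode; computability.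
  + apply: computable_has; last by computability.
    apply: computable_and; first by computability.
    apply: computable_and; first by apply: computable_geq_add; computability.
    by apply: computable_geq_add; computability.
  + by computability.
- by computability.
Qed.

Lemma relativized_RE o : RE o (fun x => relativized x.1 x.2).
Proof.
apply: RE_ex; apply: RE_and.
  apply: RE_dec; apply: (computable_comp (guarantees_computable o)
    (g := fun x : nat * (seq bool * seq condition) * seq nat => (x.1.2.2, x.2))).
  by computability.
apply: RE_ex.
have segR : RE o (fun x : seq nat * (nat * nat) => segment x.1 x.2.1 x.2.2).
  by apply: RE_and; [apply: RE_dec|apply: RE_eq]; computability.
have := RE_sem (rho := fun s => sem (segment s) q) p (RE_sem (rho := segment) q segR).
move=> C; apply: (RE_comp3 (S := fun s => sem (sem (segment s) q) p)
  (f := fun x : nat * (seq bool * seq condition) * seq nat * nat => x.1.2)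
  (g := fun x => pairing x.1.1.1 x.2) (h := fun x => code x.1.1.2.1) C); computability.
by apply: computable_code; computability.
Qed.

(** The bounds are strict so that [P] satisfies the open condition [query_condition] built from the
    answer. *)
Definition close (ye : seq bool * rat) (r : rat) : Prop :=
  0 < ye.2 -> ratr r - ratr ye.2 < prob P ye.1 < ratr r + ratr ye.2.

Lemma close_ex ye : exists r, close ye r.
Proof.
have [e0|e0] := boolP (0 < ye.2); last by exists 0 => h; rewrite h in e0.
have : prob P ye.1 - ratr ye.2 < prob P ye.1 + ratr ye.2.
  by rewrite ltrD2l gtrN // ltr0q.
move=> /rat_in_itvoo[r]; rewrite in_itv /= => /andP[l u]; exists r => _.
by rewrite ltrBlDr u /= -ltrBlDr.
Qed.

Definition approximation (ye : seq bool * rat) : rat := projT1 (cid (close_ex ye)).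

Lemma approximation_close ye : close ye (approximation ye).
Proof. exact: projT2 (cid (close_ex ye)). Qed.

(** The values are picked by choice; this is legitimate because [qP] speaks of every approximating
    oracle, computable or not. *)
Definition approximation_oracle (n : nat) : nat :=
  if decode n : option (seq bool * rat) is Some ye then code (approximation ye) else 0%N.

Definition query_condition (n : nat) : option condition :=
  if decode n : option (seq bool * rat) is Some ye then
    if 0 < ye.2 then Some (ye.1, approximation ye - ye.2, approximation ye + ye.2)
    else None
  else None.

(** A finite beginning with correct answers extends to a full approximating oracle, which brings it
    within the scope of [qP]. *)
Lemma approximates_oracle s : (forall n y e, (n < size s)%N ->
    n = pairing (code_word y) (code_rat e) -> 0 < e ->
    exists2 r, nth 0%N s n = code r & `|ratr r - prob P y| <= ratr e) ->
  approximates P (fun n m =>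
    (if (n < size s)%N then nth 0%N s n else approximation_oracle n) = m).
Proof.
move=> sP y e e0; case: ifP => [lt_n|_].
  by have [r rP re] := sP _ y e lt_n erefl e0; exists r => //; rewrite probE -EFinB lee_fin.
exists (approximation (y, e)).
  by rewrite /approximation_oracle code_query codeK.
have := approximation_close (e0 : 0 < (y, e).2); rewrite /= => /andP[l u].
by rewrite probE -EFinB lee_fin ler_distl; apply/andP; split; lra.
Qed.

(** When [P] satisfies the guarantees, [s] begins a true oracle for [P]. What [q] outputs from [s]
    it also outputs from that oracle, hence it is a value of [A], and [p] only sees correct
    answers. *)
Lemma relativized_sound i z : relativized i z -> (forall c, c \in z.2 -> satisfies P c) ->
  enumerated code_word (set_oracle A) p i z.1.
Proof.
move=> [s [/allP gs [k zk]]] Pz; exists k; apply/evalP; move: zk; apply: sem_sub => a b ab.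
pose o n := if (n < size s)%N then nth 0%N s n else approximation_oracle n.
have o_approx : approximates P (fun n m => o n = m).
  apply: approximates_oracle => n y e lt_n en e0.
  have := gs n; rewrite mem_below => /(_ lt_n).
  rewrite {1}en code_query codeK /= e0 /=.
  case D : (decode (nth 0%N s n)) =>
    [r|//] /hasP[c /Pz/satisfiesE/andP[l u] /and3P[/eqP ey lr ur]].
  exists r; first exact: (esym (decodeK D)).
  rewrite ey in l u; rewrite -!(ler_rat R) !rmorphD /= in lr ur.
  by rewrite ler_distl; apply/andP; split; lra.
have : eval o q a b.
  by apply/evalP; move: ab; apply: sem_sub => n m [lt_n <-]; rewrite /graph /o lt_n.
by move=> ab'; exact: eval_fun (qP o_approx a) ab'.
Qed.

(** The use principle applies twice: [p] asks for finitely many values of [A], and [q] computes each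
    from finitely many approximations. One length [N] suffices for all of them, and [beta] collects
    the conditions certifying the first [N] answers. *)
Lemma relativized_complete i y : enumerated code_word (set_oracle A) p i y ->
  exists2 beta, relativized i (y, beta) & forall c, c \in beta -> satisfies P c.
Proof.
move=> [k /evalP yk].
have o_approx : approximates P (fun n m => approximation_oracle n = m).
  by apply: (@approximates_oracle [::]).
pose s N := mkseq approximation_oracle N.
have sub N N' a b : (N <= N')%N -> segment (s N) a b -> segment (s N') a b.
  rewrite /segment !size_mkseq => le_N [lt_a <-]; split; first exact: leq_trans le_N.
  by rewrite !nth_mkseq // (leq_trans lt_a).
have {yk} : sem (fun a b => exists N, sem (segment (s N)) q a b) p (pairing i k)
  (code_word y).
  move: yk; apply: sem_sub => a b <-; apply: sem_cont; first exact: sub.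
  have /evalP := qP o_approx a; apply: sem_sub => n m <-.
  by exists n.+1; split; rewrite ?size_mkseq // nth_mkseq.
move=> /sem_cont[|N sN].
  by move=> N N' a b le_N; apply: sem_sub => ? ?; exact: sub.
exists (pmap query_condition (below N)); last first.
  move=> c; rewrite mem_pmap => /mapP[n _]; rewrite /query_condition;
    case: (decode n) => // ye.
  case: ifP => // e0 [->]; apply/satisfiesE; rewrite /= rmorphB rmorphD /=.
  exact: approximation_close.
exists (s N); split; last by exists k.
apply/allP => n; rewrite mem_below size_mkseq => lt_n.
case D : (decode n) => [ye|//]; apply/implyP => e0.
rewrite nth_mkseq // /approximation_oracle D codeK; apply/hasP.
exists (ye.1, approximation ye - ye.2, approximation ye + ye.2);
  last by rewrite /= eqxx subrK !lexx.
by rewrite mem_pmap; apply/mapP; exists n; rewrite ?mem_below // /query_condition D e0.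
Qed.

End relativization.

Theorem martin_lof_random_of_random (R : realType)
    (t : Omega -> probability Omega R -> \bar R)
    P (A : nat -> bool) w :
  universal_uniform_test t -> computable_from_approximations A P ->
  uniformly_random t P w -> martin_lof_random P A w.
Proof.
move=> [_ t_max] [q qP] tw U [[p pP] U_le] Uw.
(* Level [2 * i + 1] has [P]-measure at most half of [4 ^ -i], which provides the strict inequality
   that [trimmed_complete] requires. *)
have [T TC TP] : RE no_oracle
  (fun x : nat * (seq bool * seq condition) => relativized p q (2 * x.1).+1 x.2).
  apply: (RE_comp (S := fun x => relativized p q x.1 x.2)
    (f := fun x => ((2 * x.1).+1, x.2))).
    exact: relativized_RE.
  by computability.
have sliceE i : slice (fun z => exists s, T (i, z) s) P = U (2 * i).+1.
  rewrite pP; apply/seteqP; split=> v.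
    move=> [z [/(TP (i, z)) zi Pz zv]]; exists z.1 => //.
    exact: (relativized_sound qP zi).
  move=> [y yi yv]; have [beta beta_i Pbeta] := relativized_complete qP yi.
  by exists (y, beta); split=> //; apply/(TP (i, (y, beta))).
have [c c0 /(_ w P)] := t_max _ (trimmed_testP TC).
rewrite trimmed_test_pinfty; last first.
  move=> i; apply: trimmed_complete; rewrite sliceE; last exact: Uw.
  apply: le_lt_trans (U_le _) _; rewrite lte_fin exprS exprM.
  have -> : 4^-1 = 2^-1 ^+ 2 :> R by rewrite expr2 -invfM -natrM.
  by rewrite gtr_pMl ?exprn_gt0 // ?exprn_gt0 // invf_lt1 // ltr1n.
apply/negP; rewrite -ltNge.
move: tw; rewrite /uniformly_random.
case: (t w P) => [r _| // | _]; first by rewrite -EFinM ltry.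
by rewrite gt0_muleNy.
Qed.

Theorem theorem12 (R : realType)
    (t : Omega -> probability Omega R -> \bar R)
    (t_universal : universal_uniform_test t)
    (P : probability Omega R) (A : nat -> bool)
    (P_computable : computable_relative_to P A)
    (A_computable : computable_from_approximations A P)
    (w : Omega) :
  uniformly_random t P w <-> martin_lof_random P A w.
Proof.
split; first exact: martin_lof_random_of_random.
exact: random_of_martin_lof_random t_universal.1 P_computable.
Qed.
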